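(* Let $W$ be any finite real reflection group of rank $\ell$ with set of reflections $T$, root system $\Phi$, fixed choice of a positive system $\Phi^+$ and Coxeter number $h$. Let $\{\sigma_1,\sigma_2,\dots,\sigma_\ell\}$ be a choice of simple system for $\Phi$ such that $\{\sigma_1,\dots,\sigma_r\}$ and $\{\sigma_{r+1},\dots,\sigma_\ell\}$ are orthonormal sets for some $r$, and let $\gamma=t_{\sigma_1}t_{\sigma_2}\cdots t_{\sigma_\ell}$. Then $\Phi^+=\{\rho_1,\rho_2,\dots,\rho_{\ell h/2}\}$, where $\rho_i=t_{\sigma_1}t_{\sigma_2}\cdots t_{\sigma_{i-1}}(\sigma_i)$ for $1\le i\le \ell h/2$ and the $\sigma_j$ are indexed cyclically modulo $\ell$ (a recalled fact, proved by Steinberg under the additional assumption that $W$ is irreducible, which is stated not to be needed here). If $T$ is totally ordered by $$t_{\rho_1}<t_{\rho_2}<\cdots<t_{\rho_{\ell h/2}},$$ then the Möbius function on any interval $[u,v]$ in $\mathrm{NC}_W(\gamma)$ is equal to $(-1)^{l_T(v)-l_T(u)}$ times the number of falling maximal chains in $[u,v]$ with respect to the natural edge labeling of $\mathrm{NC}_W(\gamma)$.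
   Context: $W$ acts faithfully by orthogonal transformations on an $\ell$-dimensional Euclidean space $V$ and is generated by orthogonal reflections. $\Phi$ is $W$-invariant and consists of one pair $\{\alpha,-\alpha\}$ of nonzero vectors for each reflection in $W$, orthogonal to its reflecting hyperplane; $t_\alpha$ is the orthogonal reflection in the hyperplane orthogonal to $\alpha$. A Coxeter element is the product of the simple reflections, in an arbitrary order, for any choice of simple system for $\Phi$; the Coxeter number $h$ is the order of any Coxeter element. For $w\in W$, $l_T(w)$ is the smallest $k$ such that $w$ is a product of $k$ reflections in $T$; $u\preceq v$ if and only if $l_T(u)+l_T(u^{-1}v)=l_T(v)$; $\mathrm{NC}_W(w)$ is the interval $[1,w]$ in $(W,\preceq)$, graded with rank function $l_T$. Every covering relation $(u,v)$ of $\mathrm{NC}_W(\gamma)$ satisfies $u^{-1}v\in T$; the natural edge labeling is $\lambda(u,v)=u^{-1}v$, with label set $T$. The label of an unrefinable chain $x_0<x_1<\cdots<x_r$ is $(\lambda(x_0,x_1),\dots,\lambda(x_{r-1},x_r))$, and the chain is falling if the entries of its label weakly decrease in the total order of $T$.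
   Formalization: Φ⁺={ρ_i} is claimed only if all irreducible components of W have Coxeter number h (it fails e.g. for A1×A2, where ρ_4=−σ_1); otherwise only Φ⁺⊆{ρ_i}, and T is ordered by first occurrence in the list t_{ρ_1}, t_{ρ_2}, …. The σ_i are taken in Φ⁺. *)

(* Defs.v *)
From HB Require Import structures.
From mathcomp Require Import all_boot all_order all_algebra all_fingroup.
From mathcomp Require Import all_character.
From mathcomp Require Import boolp reals.

Set Implicit Arguments.
Unset Strict Implicit.
Unset Printing Implicit Defensive.

Import Order.TTheory GRing.Theory Num.Theory.

Local Open Scope ring_scope.

(* The Euclidean space is R^l, given by column vectors with the standard inner
   product. Matrices act on the left of column vectors, so a product of group
   elements is the composition of maps, the rightmost factor acting first. *)

Definition dot (R : realType) (l : nat) (x y : 'cV[R]_l) : R := (x^T *m y) 0 0.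

(* x |-> x - 2 <a, x> / <a, a> a *)
Definition refl_mx (R : realType) (l : nat) (a : 'cV[R]_l) : 'M[R]_l :=
  1%:M - (2 / dot a a) *: (a *m a^T).

Section ReflectionGroup.

Variables (R : realType) (gT : finGroupType) (W : {group gT}) (l : nat).
Variable rW : mx_representation R W l.

Definition orthogonal_repr : Prop :=
  forall w, w \in W -> (rW w)^T *m rW w = 1%:M.

Definition reflections : {set gT} :=
  [set w in W | `[< exists2 a : 'cV[R]_l, a != 0 & rW w = refl_mx a >]].

Definition real_reflection_group : Prop :=
  [/\ mx_faithful rW, orthogonal_repr & <<reflections>>%g = W].

Definition root_system (Phi : 'cV[R]_l -> Prop) : Prop :=
  [/\ forall a, Phi a ->
        a != 0 /\ (exists2 t, t \in reflections & rW t = refl_mx a),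
      forall t, t \in reflections ->
        exists2 a, Phi a &
          forall b, Phi b /\ rW t = refl_mx b <-> b = a \/ b = - a
    & forall w a, w \in W -> Phi a -> Phi (rW w *m a)].

Definition positive_system (Phi Pos : 'cV[R]_l -> Prop) : Prop :=
  exists c : 'cV[R]_l,
    (forall a, Phi a -> dot c a != 0) /\
    (forall a, Pos a <-> Phi a /\ 0 < dot c a).

(* The rank of W is the dimension of the space, hence a simple system has
   exactly l elements. *)
Definition simple_system (Phi : 'cV[R]_l -> Prop) (sigma : l.-tuple 'cV[R]_l) :
    Prop :=
  [/\ forall i, Phi (tnth sigma i),
      free sigma
    & forall a, Phi a -> exists2 k : 'I_l -> R,
        a = \sum_i k i *: tnth sigma i &
        (forall i, 0 <= k i) \/ (forall i, k i <= 0)].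

(* The element t_a of W acting as the reflection refl_mx a; it is unique when rW
   is faithful, and the default value 1 is not used when a is a root. *)
Definition root_refl (a : 'cV[R]_l) : gT :=
  odflt 1%g [pick w in W | rW w == refl_mx a].

Section SimpleSystem.

Variable sigma : l.-tuple 'cV[R]_l.

Definition coxeter_elt : gT := (\prod_(a <- sigma) root_refl a)%g.

Definition coxeter_number : nat := #[coxeter_elt]%g.

Definition coxeter_graph : rel 'I_l :=
  [rel i j | dot (tnth sigma i) (tnth sigma j) != 0].

(* The Coxeter number of the irreducible component of W containing the i-th
   simple reflection. *)
Definition component_coxeter_number (i : 'I_l) : nat :=
  #[(\prod_(j < l | connect coxeter_graph i j) root_refl (tnth sigma j))%g]%g.

Definition cyclic_simple (k : nat) : 'cV[R]_l := sigma`_(k %% l).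

(* Indices start at 0: rho k is the root usually written rho_(k+1). *)
Definition rho (k : nat) : 'cV[R]_l :=
  rW (\prod_(j < k) root_refl (cyclic_simple j))%g *m cyclic_simple k.

Definition num_rho : nat := (l * coxeter_number)./2.

Definition rho_seq : seq 'cV[R]_l := [seq rho k | k <- iota 0 num_rho].

(* The order t_(rho 0) < t_(rho 1) < ... on reflections. If the list has
   repetitions (W reducible with components of different Coxeter numbers), a
   reflection is placed at its first occurrence. *)
Definition refl_le : rel gT :=
  [rel s t | index s (map root_refl rho_seq) <= index t (map root_refl rho_seq)]%N.

End SimpleSystem.

End ReflectionGroup.

Section AbsoluteOrder.

Variables (gT : finGroupType) (W T : {set gT}).

(* (T ^+ k)%g is the set of products of k elements of T; the value 0 outside of
   the subgroup generated by T is junk. *)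
Definition abs_length (w : gT) : nat :=
  if pselect (exists k, w \in (T ^+ k)%g) is left ex then ex_minn ex else 0%N.

Definition abs_le : rel gT :=
  [rel u v | abs_length u + abs_length (u^-1 * v)%g == abs_length v]%N.

Definition noncrossing (w : gT) : {set gT} :=
  [set x in W | abs_le 1%g x && abs_le x w].

End AbsoluteOrder.

Section Poset.

Variables (X : finType) (P : {set X}) (le : rel X).

(* Each recursive call strictly decreases v inside P, so a number n of calls
   equal to #|P| is never exhausted before reaching u. *)
Fixpoint mobius_rec (n : nat) (u v : X) : int :=
  if u == v then 1
  else if n is m.+1 then
    - \sum_(x in P | [&& le u x, le x v & x != v]) mobius_rec m u x
  else 0.

Definition mobius (u v : X) : int := mobius_rec #|P| u v.

Definition covers : rel X :=
  [rel x y | [&& x \in P, y \in P, le x y, x != y &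
    [forall z in P, le x z && le z y ==> (z == x) || (z == y)]]].

(* A maximal chain of [u, v] is given by its elements other than u. *)
Definition maximal_chain (u v : X) (p : seq X) : bool :=
  path covers u p && (last u p == v).

End Poset.

Definition edge_labels (gT : finGroupType) (u : gT) (p : seq gT) : seq gT :=
  pairmap (fun x y => x^-1 * y)%g u p.

Definition falling (gT : finGroupType) (leT : rel gT) (u : gT) (p : seq gT) :
    bool :=
  sorted [rel s t | leT t s] (edge_labels u p).

(* The elements of a chain are distinct, so bounding the length by the order of
   the group loses no chain. *)
Definition falling_maximal_chains (gT : finGroupType) (P : {set gT})
    (le leT : rel gT) (u v : gT) : {set {bseq #|gT| of gT}} :=
  [set p : {bseq #|gT| of gT} | maximal_chain P le u v p && falling leT u p].

(* Main.v *)
(* The form E(x, y) = 2 <(1 - gamma)^-1 x, y> is gamma-invariant and satisfies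
   Serre duality E(x, y) = - E(gamma y, x). If gamma is a product of l reflections
   with unit roots e_1, ..., e_l, then E(e_i, e_j) = 0 for i < j. For the simple
   roots, E(rho_i, y) with i <= l is the coefficient of sigma_i in y, and it follows
   that E(rho_i, rho_j) is >= 0 if i <= j and <= 0 if i > j. Hence in a rising
   reduced factorization of an interval of NC(gamma) the first root must be the
   smallest positive root in the span, and the factorization is unique; it exists
   because a reduced factorization with smallest first letter can be sorted by
   conjugation. So every interval has exactly one rising maximal chain, and the
   Moebius function counts falling chains by cancelling, for each maximal chain,
   the two ways to cut it into a falling and a rising part.

   The enumeration of the positive roots uses the products c_1, c_2 of commuting
   simple reflections with gamma = c_1 c_2: in the orbit of a root under c_1 and
   c_2 applied alternately, the sign changes exactly at simple roots, and each sign
   change is a centre of antisymmetry. *)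

Require Import Defs.
From HB Require Import structures.
From mathcomp Require Import all_boot all_order all_algebra all_fingroup.
From mathcomp Require Import all_character.
From mathcomp Require Import boolp reals.
From mathcomp Require cyclic.
From mathcomp Require Import zify ring lra.

Set Implicit Arguments.
Unset Strict Implicit.
Unset Printing Implicit Defensive.

Import Order.TTheory GRing.Theory Num.Theory.

Local Open Scope ring_scope.

(** * Words in the reflections and absolute length *)

(** When [W] is reducible, [h] is the least common multiple of the Coxeter numbers of the
    components, so the list of the [rho k] may run past the positive roots of one component into
    negative roots and repetitions. This shapes three points. The order on reflections goes by first
    occurrence, and the signs of E depend on locating it: a positive root [a] first occurs at
    [j + m * l], where all its translates by [g ^- i] with [i <= m] are still positive. In general
    only the inclusion of the positive roots in the list holds. Its converse asks that every
    positive run starting at a simple root have length at least [h]; additive relations between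
    neighbouring orbits make a globally shortest run length constant on its component, where that
    power of gamma is then trivial. Uniqueness of rising words is proved for a block of a
    factorization of gamma into [l] letters: the roots of the whole factorization form a basis, and
    its dual basis reads off coordinates. *)

Section Words.

Variables (gT : finGroupType) (T : {set gT}).
Implicit Types (s : seq gT) (w : gT).

Fixpoint words (k : nat) : seq (seq gT) :=
  if k is k'.+1 then [seq t :: s | t <- enum T, s <- words k'] else [:: [::]].

Lemma mem_words k s : (s \in words k) = (size s == k) && all (mem T) s.
Proof.
elim: k s => [|k IHk] [|t s] //=.
  by apply/negP => /allpairsP[p [_ _]].
rewrite eqSS andbCA -IHk.
apply/allpairsP/andP => [[[t' s'] /= [tT sk [-> ->]]]|[tT sk]].
  by rewrite -mem_enum.
by exists (t, s); rewrite /= mem_enum.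
Qed.

Lemma words_uniq k : uniq (words k).
Proof.
elim: k => //= k IHk; apply: allpairs_uniq => //; first exact: enum_uniq.
by move=> [t s] [t' s'] _ _ /= [-> ->].
Qed.

Lemma big_words_cat (V : nmodType) i j (F : seq gT -> V) :
  \sum_(s <- words (i + j)) F s =
  \sum_(a <- words i) \sum_(b <- words j) F (a ++ b).
Proof.
elim: i F => [|i IHi] F /=; first by rewrite big_seq1.
rewrite !big_allpairs_dep; apply: eq_bigr => t _.
exact: (IHi (fun s => F (t :: s))).
Qed.

Lemma mem_expgs k w :
  reflect (exists2 s, s \in words k & (\prod_(t <- s) t)%g = w) (w \in (T ^+
    k)%g).
Proof.
elim: k w => [|k IHk] w.
  rewrite expg0 inE; apply: (iffP eqP) => [->|[[|t s] //]].
    by exists [::] => //; rewrite big_nil.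
  by rewrite big_nil.
rewrite expgS; apply: (iffP mulsgP) => [[t w' tT /IHk[s sk <-] ->]|].
  exists (t :: s); last by rewrite big_cons.
  by move: sk; rewrite !mem_words /= => /andP[/eqP -> ->]; rewrite eqxx tT.
case=> -[|t s]; rewrite mem_words //= => /and3P[sk tT sT] <-.
exists t (\prod_(t <- s) t)%g; rewrite ?big_cons //.
by apply/IHk; exists s => //; rewrite mem_words -eqSS sk.
Qed.

End Words.

Section AbsoluteOrder.

Variables (gT : finGroupType) (W : {group gT}) (T : {set gT}).
Hypotheses (genT : <<T>>%g = W) (invT : forall t, t \in T -> (t * t = 1)%g).
Hypothesis conjT : forall s t, s \in T -> t \in T -> (s ^ t)%g \in T.

Local Notation len := (abs_length T).
Local Notation le := (abs_le T).

Lemma memT_W t : t \in T -> t \in W.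
Proof. by rewrite -genT; exact: mem_gen. Qed.

Lemma memT_prod s : all (mem T) s -> (\prod_(t <- s) t)%g \in W.
Proof.
move=> /allP sT; rewrite big_seq; apply: group_prod => t ts.
exact/memT_W/sT.
Qed.

Lemma mem_expgs_abs_length w : w \in W -> w \in (T ^+ len w)%g.
Proof.
rewrite -genT => /gen_prodgP[n [c cT wE]]; rewrite /abs_length.
case: pselect => [ex|]; first by case: ex_minnP.
case; exists n; apply/mem_expgs; exists [seq c i | i <- index_enum 'I_n].
  rewrite mem_words size_map /index_enum unlock -enumT size_enum_ord eqxx.
  by apply/allP => _ /mapP[i _ ->]; exact: cT.
by rewrite big_map.
Qed.

Lemma abs_length_leq w k : w \in (T ^+ k)%g -> (len w <= k)%N.
Proof.
move=> wk; rewrite /abs_length.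
by case: pselect => [ex|//]; case: ex_minnP => m _; apply.
Qed.

Lemma abs_lengthP w : w \in W ->
  exists2 s, size s = len w & all (mem T) s /\ (\prod_(t <- s) t)%g = w.
Proof.
move/mem_expgs_abs_length/mem_expgs => [s].
by rewrite mem_words => /andP[/eqP ? ?] ?; exists s.
Qed.

Lemma abs_length_prod s :
  all (mem T) s -> (len (\prod_(t <- s) t)%g <= size s)%N.
Proof.
by move=> sT; apply/abs_length_leq/mem_expgs; exists s;
  rewrite ?mem_words ?eqxx.
Qed.

Lemma abs_length1 : len 1%g = 0%N.
Proof. by have := @abs_length_prod [::] isT; rewrite big_nil leqn0 => /eqP. Qed.

Lemma abs_length_eq0 w : w \in W -> len w = 0%N -> w = 1%g.
Proof.
move=> /abs_lengthP[s sz [_ wE]] w0.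
by rewrite -wE (size0nil (etrans sz w0)) big_nil.
Qed.

Lemma abs_length_mul x y : x \in W -> y \in W ->
  (len (x * y)%g <= len x + len y)%N.
Proof.
move=> /abs_lengthP[s <- [sT <-]] /abs_lengthP[s' <- [s'T <-]].
rewrite -big_cat -size_cat; apply: abs_length_prod.
by rewrite all_cat sT.
Qed.

Lemma abs_le_refl x : le x x.
Proof. by rewrite /abs_le /= mulVg abs_length1 addn0. Qed.

Lemma abs_le_leq x y : le x y -> (len x <= len y)%N.
Proof. by move=> /eqP <-; exact: leq_addr. Qed.

Lemma abs_length_div x y : le x y -> len (x^-1 * y)%g = (len y - len x)%N.
Proof. by move=> /eqP <-; rewrite addKn. Qed.

Lemma abs_le_trans x y z : x \in W -> y \in W -> z \in W ->
  le x y -> le y z -> le x z.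
Proof.
move=> xW yW zW /eqP xy /eqP yz; rewrite /abs_le /= eqn_leq; apply/andP; split.
  rewrite -yz -xy -addnA leq_add2l.
  have -> : (x^-1 * z = (x^-1 * y) * (y^-1 * z))%g by rewrite mulgA mulgK.
  by apply: abs_length_mul; rewrite ?groupM ?groupV.
have {1}-> : (z = x * (x^-1 * z))%g by rewrite mulKVg.
by apply: abs_length_mul; rewrite ?groupM ?groupV.
Qed.

Lemma abs_le_eq x y : x \in W -> y \in W -> le x y -> len x = len y -> x = y.
Proof.
move=> xW yW xy lxy; have := abs_length_div xy; rewrite lxy subnn.
move=> /abs_length_eq0 -/(_ (groupM (groupVr xW) yW)) xy1.
by rewrite -(mulKVg x y) xy1 mulg1.
Qed.

(** Subadditivity bounds [len w] by the lengths of the two factors, each at most the size of its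
    word; the total size leaves no slack in either bound. *)
Lemma abs_le_prefix a b w : all (mem T) a -> all (mem T) b ->
  (\prod_(t <- a) t * \prod_(t <- b) t)%g = w -> (size a + size b = len w)%N ->
  [/\ len (\prod_(t <- a) t)%g = size a, len (\prod_(t <- b) t)%g = size b
    & le (\prod_(t <- a) t)%g w].
Proof.
move=> aT bT wE sz.
have la := abs_length_prod aT; have lb := abs_length_prod bT.
have := abs_length_mul (memT_prod aT) (memT_prod bT).
rewrite wE -sz => lab.
have e1 : len (\prod_(t <- a) t)%g = size a by apply/eqP;
  rewrite eqn_leq la -(leq_add2r (size b)) (leq_trans lab) // leq_add2l.
have e2 : len (\prod_(t <- b) t)%g = size b by apply/eqP;
  rewrite eqn_leq lb -(leq_add2l (size a)) (leq_trans lab) // leq_add2r.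
by split=> //; rewrite /abs_le /= -wE mulKg e1 e2 wE sz.
Qed.

End AbsoluteOrder.

(** * Counting factorizations of a group element *)

Section WordCount.

Variables (gT : finGroupType) (T : {set gT}).
Implicit Types (P Q : pred (seq gT)).

Definition word_count P k (w : gT) : int :=
  \sum_(s <- words T k) (((\prod_(t <- s) t)%g == w) && P s)%:R.

(** The intermediate element [x] is forced to be the product of the first word, so a convolution
    over the group is a sum over words with a marked cut. *)
Lemma word_count_conv P Q i j w :
  \sum_x word_count P i x * word_count Q j (x^-1 * w)%g =
  \sum_(a <- words T i) \sum_(b <- words T j)
    (((\prod_(t <- a ++ b) t)%g == w) && (P a && Q b))%:R.
Proof.
under eq_bigr do rewrite big_distrlr.
rewrite exchange_big; apply: eq_bigr => a _.
rewrite exchange_big; apply: eq_bigr => b _.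
rewrite (bigD1 (\prod_(t <- a) t)%g) //= eqxx [X in _ + X]big1 ?addr0;
  last first.
  by move=> x; rewrite eq_sym => /negbTE ->; rewrite mul0r.
rewrite -natrM mulnb big_cat /= andbCA.
by rewrite -(can_eq (mulKg (\prod_(t <- a) t)%g)) mulKVg.
Qed.

Lemma word_count_neq0 P k w : word_count P k w != 0 ->
  exists2 s, s \in words T k & (\prod_(t <- s) t)%g = w /\ P s.
Proof.
move=> /eqP c0; apply: contrapT => ns; apply: c0.
rewrite /word_count big1_seq // => s /= sk.
by case: andP => // -[/eqP sw Ps]; case: ns; exists s.
Qed.

Lemma word_count_eq1 P k w s : s \in words T k -> (\prod_(t <- s) t)%g = w ->
  P s ->
  (forall s', s' \in words T k -> (\prod_(t <- s') t)%g = w -> P s' -> s' = s)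
    ->
  word_count P k w = 1.
Proof.
move=> sk sw Ps us; rewrite /word_count (bigD1_seq s) ?words_uniq //=.
rewrite sw eqxx Ps big1_seq ?addr0 // => s' /andP[ne s'k].
by case: andP => // -[/eqP s'w Ps']; rewrite (us s') ?eqxx in ne.
Qed.

End WordCount.

(** * Rising and descending words *)

Section Rearrangement.

Variables (gT : finGroupType) (T : {set gT}) (k : gT -> nat).
Hypothesis conjT : forall s t, s \in T -> t \in T -> (s ^ t)%g \in T.

Definition rising : pred (seq gT) := sorted [rel s t | k s <= k t]%N.

(* Choose the smallest possible first letter [t]; if the next letter is [t1], then
   [t * t1 = t1 * t ^ t1] shows that [t1] is also a possible first letter. *)
Lemma rising_word n w : w \in (T ^+ n)%g ->
  exists2 s, s \in words T n & (\prod_(t <- s) t)%g = w /\ rising s.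
Proof.
elim: n w => [|n IHn] w.
  by move=> /mem_expgs[s]; rewrite mem_words => /andP[/nilP -> _] <-;
    exists [::].
rewrite expgS => /mulsgP[t0 w0 t0T w0n wE].
pose first t := (t \in T) && ((t^-1 * w)%g \in (T ^+ n)%g).
have f0 : first t0 by rewrite /first t0T wE mulKg.
case: (arg_minnP k f0) => t /andP[tT /IHn[s sn [sw ss]]] tmin.
exists (t :: s); first by move: sn; rewrite !mem_words /= tT eqSS.
rewrite big_cons sw mulKVg; split=> //=.
case: s sn sw ss => //= t1 s sn sw ss; apply/andP; split=> //.
move: sn; rewrite mem_words /= => /and3P[sn t1T sT].
apply: tmin; rewrite /first t1T /=.
have -> : (t1^-1 * w = t ^ t1 * \prod_(j <- s) j)%g.
  by rewrite -(mulKVg t w) -sw big_cons conjgE !mulgA.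
case: n sn {IHn f0 first w0n} => // n; rewrite eqSS => sn.
rewrite expgS; apply: mem_mulg; first exact: conjT.
by apply/mem_expgs; exists s; rewrite ?mem_words ?sn.
Qed.

End Rearrangement.

Section Valley.

Variables (gT : finGroupType) (k : gT -> nat).
Local Notation rising := (rising k).

Definition descending : pred (seq gT) := sorted [rel s t | k t <= k s]%N.

(* A nonempty word that is a descending word followed by a rising one can be cut
   that way at exactly two consecutive places, one on each side of its
     minimum. *)
Lemma rising_descending_sum x s :
  sorted [rel a b | k a != k b] (x :: s) ->
  \sum_(i < (size s).+2)
    (-1) ^+ i * (descending (take i (x :: s)) && rising (drop i (x :: s)))%:R
  = 0 :> int.
Proof.
elim: s x => [|y s IHs] x.
  by move=> _; rewrite !big_ord_recl big_ord0 /= expr0 expr1 /=; lia.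
move=> /= /andP[xy ys]; rewrite big_ord_recl /= expr0 mul1r.
have [lt_xy|le_yx] := ltnP (k x) (k y).
  rewrite big_ord_recl big1 => [|i _] /=.
    by rewrite /bump /= expr1 ltnW //=; lia.
  by rewrite leqNgt lt_xy /= mulr0.
have {xy le_yx} lt_yx : (k y < k x)%N by rewrite ltn_neqAle eq_sym xy.
rewrite leqNgt lt_yx /= add0r; apply: (@oppr_inj int); rewrite oppr0 -sumrN.
apply: etrans (IHs y ys); apply: eq_bigr => -[[|i] ilt] _;
  rewrite /bump /= add1n exprS mulN1r mulNr opprK //.
by rewrite (ltnW lt_yx).
Qed.

End Valley.

(** * The Moebius function of a poset with unique rising chains *)

Section RisingLabeling.

Variables (gT : finGroupType) (W : {group gT}) (T : {set gT}) (g : gT).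
Variable k : gT -> nat.
Hypotheses (genT : <<T>>%g = W) (invT : forall t, t \in T -> (t * t = 1)%g).
Hypothesis conjT : forall s t, s \in T -> t \in T -> (s ^ t)%g \in T.
Hypotheses (k_inj : {in T &, injective k}) (gW : g \in W).

Local Notation len := (abs_length T).
Local Notation le := (abs_le T).
Local Notation NC := (noncrossing W T g).

(** Everything special to Coxeter elements enters this section here; the rest uses only involutive
    generators closed under conjugation and an injective rank [k]. *)
Hypothesis rising_unique : forall u v s s', u \in NC -> v \in NC -> le u v ->
  s \in words T (len v - len u) -> s' \in words T (len v - len u) ->
  (\prod_(t <- s) t = u^-1 * v)%g -> (\prod_(t <- s') t = u^-1 * v)%g ->
  rising k s -> rising k s' -> s' = s.

Lemma noncrossing_W x : x \in NC -> x \in W.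
Proof. by rewrite inE => /andP[]. Qed.

Lemma noncrossingE x : (x \in NC) = (x \in W) && le x g.
Proof.
by rewrite inE /abs_le /= abs_length1 // add0n invg1 mul1g eqxx.
Qed.

Lemma noncrossing_le x v : x \in W -> v \in NC -> le x v -> x \in NC.
Proof.
move=> xW; rewrite !noncrossingE xW => /andP[vW vg] xv.
exact: (abs_le_trans genT xW vW gW xv vg).
Qed.

(** Equal neighbours would cancel, so a reduced word has none. This provides the hypothesis of
    [rising_descending_sum]. *)
Lemma reduced_distinct s : all (mem T) s ->
  len (\prod_(t <- s) t)%g = size s -> sorted [rel a b | k a != k b] s.
Proof.
have lt_s a : all (mem T) a -> (len (\prod_(t <- a) t)%g <= size a)%N.
  exact: abs_length_prod.
elim: s => [|t [|t' s] IHs] // sT sz; have /and3P[tT t'T s'T] := sT.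
have t'sT : all (mem T) (t' :: s) by case/andP: sT.
rewrite /=; apply/andP; split.
  apply: contra_eqN sz => /eqP /(k_inj tT t'T) <-.
  rewrite !big_cons mulgA (invT tT) mul1g /= neq_ltn ltnS.
  by rewrite (leq_trans (lt_s _ s'T)).
apply: IHs => //; apply/eqP; rewrite eqn_leq (lt_s (t' :: s)) //=.
have := abs_length_mul genT (memT_W genT tT) (memT_prod genT t'sT).
move: sz; rewrite [in len _]big_cons => -> /=.
have : (len t <= 1)%N by have := lt_s [:: t]; rewrite big_seq1; apply;
  rewrite /= andbT.
by move=> l1 l2; rewrite -ltnS (leq_trans l2) // -add1n leq_add2r.
Qed.

Lemma rising_count1 u v : u \in NC -> v \in NC -> le u v ->
  word_count T (rising k) (len v - len u) (u^-1 * v)%g = 1.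
Proof.
move=> uN vN uv; have uW := noncrossing_W uN; have vW := noncrossing_W vN.
have : (u^-1 * v)%g \in (T ^+ (len v - len u))%g.
  rewrite -(abs_length_div uv); apply: (mem_expgs_abs_length genT).
  by rewrite groupM ?groupV.
move=> /(rising_word k conjT)[s sT [sw ss]].
apply: (word_count_eq1 sT sw ss) => s' s'T s'w ss'.
exact: (rising_unique uN vN uv sT s'T).
Qed.

Definition signed_count u v : int :=
  (-1) ^+ (len v - len u) *
  word_count T (descending k) (len v - len u) (u^-1 * v)%g.

(** Exchanging sums leaves, for each reduced word of [w], the alternating count of its cuts into a
    descending and a rising part, which vanishes word by word. *)
Lemma word_sum n w : w \in W -> len w = n.+1 ->
  \sum_x \sum_(i < n.+2) (-1) ^+ i *
    (word_count T (descending k) i x *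
     word_count T (rising k) (n.+1 - i) (x^-1 * w)%g) = 0.
Proof.
move=> wW lw; rewrite exchange_big /=.
under eq_bigr do rewrite -mulr_sumr word_count_conv.
transitivity (\sum_(s <- words T n.+1 | (\prod_(t <- s) t)%g == w)
   \sum_(i < n.+2) (-1) ^+ i * (descending k (take i s) && rising k (drop i
     s))%:R : int).
  rewrite [RHS]exchange_big; apply: eq_bigr => i _.
  have e : n.+1 = (i + (n.+1 - i))%N by rewrite subnKC // -ltnS.
  have -> : words T n.+1 = words T (i + (n.+1 - i)) by rewrite -e.
  rewrite -mulr_sumr; congr (_ * _).
  rewrite [RHS]big_mkcond big_words_cat /= big_seq [RHS]big_seq.
  apply: eq_bigr => a; rewrite mem_words => /andP[/eqP sa _].
  apply: eq_bigr => b _; rewrite -sa take_size_cat // drop_size_cat //.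
  by case: eqP.
rewrite big1_seq // => -[|t s] /andP[/eqP sw];
  rewrite mem_words => /andP[/eqP sz sT] //.
case: sz => sz; rewrite -sz; apply: rising_descending_sum.
by apply: reduced_distinct => //; rewrite sw lw /= sz.
Qed.

Lemma factor_split u v x a b : u \in NC -> v \in NC -> le u v ->
  all (mem T) a -> all (mem T) b -> (\prod_(t <- a) t = u^-1 * x)%g ->
  (\prod_(t <- b) t = x^-1 * v)%g -> (size a + size b = len v - len u)%N ->
  [/\ x \in NC, le u x, le x v & len x = (len u + size a)%N].
Proof.
move=> uN vN uv aT bT aE bE sab.
have uW := noncrossing_W uN; have vW := noncrossing_W vN.
have abE : (\prod_(t <- a) t * \prod_(t <- b) t = u^-1 * v)%g.
  by rewrite aE bE mulgA mulgK.
rewrite -(abs_length_div uv) in sab.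
have [la lb _] := abs_le_prefix genT aT bT abE sab.
rewrite aE in la; rewrite bE in lb; rewrite (abs_length_div uv) in sab.
have uxW : (u^-1 * x)%g \in W by rewrite -aE (memT_prod genT).
have xW : x \in W by rewrite -(mulKVg u x) groupM.
have := abs_length_mul genT uW uxW; rewrite mulKVg la => lux.
have xvW : (x^-1 * v)%g \in W by rewrite groupM ?groupV.
have := abs_length_mul genT xW xvW; rewrite mulKVg lb => lxv.
have [lxE lvE] : (len u + size a = len x /\ len x + size b = len v)%N.
  move: (abs_le_leq uv) sab lux lxv.
  by move: (len u) (len x) (len v) (size a) (size b); clear; lia.
have ux : le u x by rewrite /abs_le /= la lxE.
have xv : le x v by rewrite /abs_le /= lb lvE.
by split=> //; exact: noncrossing_le xW vN xv.
Qed.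

Lemma word_count_split P Q u v x i : u \in NC -> v \in NC -> le u v ->
  (i <= len v - len u)%N -> word_count T P i (u^-1 * x)%g != 0 ->
  word_count T Q (len v - len u - i) (x^-1 * v)%g != 0 ->
  [/\ x \in NC, le u x, le x v & i = (len x - len u)%N].
Proof.
move=> uN vN uv le_i /word_count_neq0[a];
  rewrite mem_words => /andP[/eqP sa aT] [aE _].
move=> /word_count_neq0[b]; rewrite mem_words => /andP[/eqP sb bT] [bE _].
have [|-> -> -> ->] := factor_split uN vN uv aT bT aE bE.
  by rewrite sa sb subnKC.
by rewrite addKn sa.
Qed.

(** This is the recursion defining the Moebius function. A nonzero term of [word_sum], translated by
    [u], forces [x] into the interval and [i] to be its rank above [u]; there the rising factor is 1
    by existence and uniqueness of rising words. *)
Lemma signed_count_sum u v : u \in NC -> v \in NC -> le u v -> u != v ->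
  \sum_(x in NC | le u x && le x v) signed_count u x = 0.
Proof.
move=> uN vN uv neq_uv; have uW := noncrossing_W uN;
  have vW := noncrossing_W vN.
have wW : (u^-1 * v)%g \in W by rewrite groupM ?groupV.
case lw: (len (u^-1 * v)%g) => [|n].
  have uv1 := abs_length_eq0 genT wW lw.
  by rewrite -(mulKVg u v) uv1 mulg1 eqxx in neq_uv.
have luv : (len v - len u)%N = n.+1 by rewrite -lw (abs_length_div uv).
have := word_sum wW lw; rewrite (reindex_inj (mulgI u^-1)%g) => sum0.
apply: etrans sum0.
rewrite [RHS](bigID (fun x => [&& x \in NC, le u x & le x v])).
have split_i x (i : 'I_n.+2) :
    word_count T (descending k) i (u^-1 * x)%g *
      word_count T (rising k) (n.+1 - i) ((u^-1 * x)^-1 * (u^-1 * v))%g != 0 ->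
    [/\ x \in NC, le u x, le x v & nat_of_ord i = (len x - len u)%N].
  rewrite mulf_eq0 negb_or => /andP[ci]; rewrite invMg invgK -mulgA mulKVg.
  have le_i : (i <= len v - len u)%N by rewrite luv -ltnS.
  have := @word_count_split _ (rising k) _ _ _ _ uN vN uv le_i ci.
  by rewrite luv.
rewrite [X in _ = _ + X]big1 ?addr0; last first.
  move=> x nx; apply: big1 => i _; apply/eqP; rewrite mulf_eq0 orbC.
  by apply: contraNT nx; case/norP => /split_i[-> -> ->].
apply: eq_big => // x /and3P[xN ux xv].
have ix : (len x - len u < n.+2)%N.
  by rewrite ltnS -luv leq_sub2r // abs_le_leq.
rewrite (bigD1 (Ordinal ix)) //= [X in _ = _ + X]big1 ?addr0; last first.
  move=> i ne; apply/eqP; rewrite mulf_eq0 orbC.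
  apply: contraNT ne => /norP[/split_i[_ _ _ ei] _].
  exact/eqP/val_inj.
rewrite /signed_count invMg invgK -mulgA mulKVg.
have -> : (n.+1 - (len x - len u) = len v - len x)%N.
  move: (abs_le_leq ux) (abs_le_leq xv) luv.
  by move: (len u) (len x) (len v); clear; lia.
by rewrite rising_count1 // mulr1.
Qed.

Let mem_interval u v x : (x \in [set x in NC | le u x && le x v]) =
  [&& x \in NC, le u x & le x v].
Proof. by rewrite !inE. Qed.

(** The fuel is compared with the size of the interval, not of [NC]: passing from [v] to a smaller
    [x] loses at least the element [v]. *)
Lemma mobius_recE n u v : u \in NC -> v \in NC -> le u v ->
  (#|[set x in NC | le u x && le x v]| <= n)%N ->
  mobius_rec NC le n u v = signed_count u v.
Proof.
elim: n u v => [|n IHn] u v uN vN uv cn /=; have [<-|neq_uv] := eqVneq u v.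
- rewrite /signed_count subnn expr0 mul1r mulVg /word_count big_seq1.
  by rewrite big_nil eqxx.
- by move: cn; rewrite leqn0 cards_eq0 => /eqP/setP/(_ u);
    rewrite mem_interval uN uv abs_le_refl inE.
- rewrite /signed_count subnn expr0 mul1r mulVg /word_count big_seq1.
  by rewrite big_nil eqxx.
have := signed_count_sum uN vN uv neq_uv.
rewrite (bigD1 v); last by rewrite vN uv abs_le_refl.
move=> /eqP; rewrite addr_eq0 => /eqP ->; congr (- _).
apply: eq_big => [x|x /and4P[xN ux xv ne]]; first by rewrite -!andbA.
apply: IHn => //; rewrite -ltnS; apply: leq_trans cn.
apply: proper_card; apply/properP; split.
  apply/subsetP => y; rewrite !mem_interval => /and3P[yN -> yx].
  rewrite yN; apply: (abs_le_trans genT _ _ _ yx xv); exact: noncrossing_W.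
exists v; rewrite !mem_interval vN uv ?abs_le_refl //.
apply: contra ne => /and3P[_ _ vx]; apply/eqP.
apply: (abs_le_eq genT) => //; try exact: noncrossing_W.
by apply/eqP; rewrite eqn_leq !abs_le_leq.
Qed.

Lemma mobiusE u v : u \in NC -> v \in NC -> le u v ->
  mobius NC le u v = signed_count u v.
Proof.
move=> uN vN uv; apply: mobius_recE => //; apply: subset_leq_card.
by apply/subsetP => x; rewrite inE => /andP[].
Qed.

(** If the rank jumped by more than one, the first letter [t] of a reduced word of [x^-1 * y] would
    give an element [x * t] strictly between. *)
Lemma covers_noncrossing x y : x \in NC -> y \in NC ->
  covers NC le x y = le x y && (len y == (len x).+1).
Proof.
move=> xN yN; have xW := noncrossing_W xN; have yW := noncrossing_W yN.
rewrite /covers /= -!/(le _ _) xN yN /=; apply/idP/idP.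
  case/and3P=> xy ne /forall_inP cov; rewrite xy /=.
  have [|s sz [sT sE]] := @abs_lengthP _ W T genT (x^-1 * y)%g.
    by rewrite groupM ?groupV.
  move: sz; rewrite (abs_length_div xy) => sz.
  case: s sz sT sE => [|t s] sz /=.
    move=> _; rewrite big_nil => e; case/eqP: ne.
    by rewrite -(mulKVg x y) -e mulg1.
  case/andP=> tT sT; rewrite big_cons => sE.
  have [||||zN xz zy lz] := @factor_split x y (x * t)%g [:: t] s xN yN xy _ sT.
  - by rewrite /= andbT.
  - by rewrite big_seq1 mulKg.
  - by rewrite invMg -mulgA -sE mulKg.
  - by rewrite -sz.
  have /orP[/eqP e|/eqP <-] := implyP (cov _ zN) (introT andP (conj xz zy)).
    by move/eqP: lz; rewrite e [size _]/= addn1 ltn_eqF.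
  by rewrite lz addn1.
case/andP=> xy /eqP lxy; rewrite xy andTb; apply/andP; split.
  by apply: contra_eqN lxy => /eqP ->; rewrite ltn_eqF.
apply/forall_inP => z zN; apply/implyP => /andP[xz zy].
have zW := noncrossing_W zN.
have := abs_le_leq zy; rewrite lxy leq_eqVlt ltnS => /orP[/eqP lz|lz].
  by rewrite (abs_le_eq genT zW yW zy) ?eqxx ?orbT // lz lxy.
rewrite (abs_le_eq genT xW zW xz) ?eqxx //.
by apply/eqP; rewrite eqn_leq lz abs_le_leq.
Qed.

Lemma prod_edge_labels (u : gT) p : (\prod_(t <- edge_labels u p) t = u^-1 *
  last u p)%g.
Proof.
elim: p u => [|x p IHp] u /=; first by rewrite big_nil mulVg.
by rewrite big_cons IHp mulgA mulgK.
Qed.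

(** Each cover consumes one letter of a reduced word; conversely the partial products of a word of
    the exact length stay in the interval, by [factor_split]. *)
Lemma maximal_chain_labels u v p : u \in NC -> v \in NC -> le u v ->
  maximal_chain NC le u v p =
  (edge_labels u p \in words T (len v - len u)) && (last u p == v).
Proof.
move=> uN vN uv; rewrite /maximal_chain; case: eqP => [pv|];
  last by rewrite !andbF.
rewrite !andbT mem_words size_pairmap.
elim: p u uN uv pv => [|x p IHp] u uN uv /= pv; first by rewrite pv subnn.
apply/andP/and3P => [[ux xp]|[sz xT pT]].
  have xN : x \in NC by case/and5P: ux.
  have xv : le x v.
    elim: p x xN pv xp {IHp ux} => [|y p IHp] x xN /= pv;
      first by rewrite pv abs_le_refl.
    case/andP=> xy yp; have yN : y \in NC by case/and5P: xy.
    have /andP[lexy _] : le x y && (len y == (len x).+1).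
      by rewrite -covers_noncrossing.
    by apply: (abs_le_trans genT _ _ _ lexy (IHp y yN pv yp));
      exact: noncrossing_W.
  move: ux; rewrite (covers_noncrossing uN xN) => /andP[ux /eqP lx].
  have := xp; rewrite (IHp x xN xv pv) => /andP[/eqP sp pT].
  split=> //; first by rewrite sp -subSn ?abs_le_leq // lx subSS.
  have [|s] := @abs_lengthP _ W T genT (u^-1 * x)%g.
    by rewrite groupM ?groupV ?noncrossing_W.
  rewrite (abs_length_div ux) lx subSnn.
  by case: s => [|t [|? ?]] //= _ []; rewrite big_seq1 andbT => tT <-.
have xT1 : all (mem T) [:: (u^-1 * x)%g] by rewrite /= andbT.
have [|||xN ux xv lx] := @factor_split u v x _ (edge_labels x p) uN vN uv xT1
  pT.
- by rewrite big_seq1.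
- by rewrite prod_edge_labels pv.
- by rewrite size_pairmap -(eqP sz).
rewrite (covers_noncrossing uN xN) ux lx addn1 eqxx; split=> //.
rewrite (IHp x xN xv pv) pT andbT; by move/eqP: sz;
  rewrite lx /= addn1 subnS => <-.
Qed.

Lemma maximal_chain_size u v p : u \in NC -> maximal_chain NC le u v p ->
  (size p <= #|gT|)%N.
Proof.
move=> uN /andP[up _]; suff : uniq p by move/card_uniqP <-; exact: max_card.
have ltr : transitive [rel x y | (len x < len y)%N] by move=> ? ? ?;
  exact: ltn_trans.
have lti : irreflexive [rel x y | (len x < len y)%N] by move=> x; exact: ltnn.
apply: (sorted_uniq ltr lti); apply: (path_sorted (x := u)).
apply: sub_path up => x y xy; have xN : x \in NC by case/and5P: xy.
have yN : y \in NC by case/and5P: xy.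
by move: xy; rewrite covers_noncrossing //= => /andP[_ /eqP ->].
Qed.

Lemma word_count_chains (leT : rel gT) u v :
  (forall s t, leT s t = (k s <= k t)%N) -> u \in NC -> v \in NC -> le u v ->
  word_count T (descending k) (len v - len u) (u^-1 * v)%g =
  (#|falling_maximal_chains NC le leT u v|)%:Z.
Proof.
move=> leTE uN vN uv.
pose F (s : seq gT) := ((\prod_(t <- s) t)%g == (u^-1 * v)%g) && descending k s.
have -> : word_count T (descending k) (len v - len u) (u^-1 * v)%g =
          (size (filter F (words T (len v - len u))))%:Z.
  rewrite size_filter -sum1_count -[RHS]natz natr_sum [RHS]big_mkcond.
  by apply: eq_bigr => s _; rewrite -/(F s); case: (F s).
congr (_%:Z); rewrite cardE -(size_map (fun p : {bseq #|gT| of gT} =>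
  edge_labels u p)).
have lastE p : last u p = (u * \prod_(t <- edge_labels u p) t)%g.
  by rewrite prod_edge_labels mulKVg.
have fallE p : falling leT u p = descending k (edge_labels u p).
  by apply: eq_sorted => s t /=; rewrite leTE.
apply/perm_size/uniq_perm.
- by rewrite filter_uniq ?words_uniq.
- rewrite map_inj_uniq ?enum_uniq // => p q e; apply: val_inj.
  apply: (can_inj (@pairmapK _ _ (fun x y => x^-1 * y)%g mulg _ u) e).
  by move=> x y; rewrite mulKVg.
move=> s; rewrite mem_filter; apply/andP/mapP => [[/andP[/eqP sE ds] sT]|[p]].
  have e : edge_labels u (scanl mulg u s) = s.
    by apply: scanlK => x y; rewrite mulKg.
  have chain : maximal_chain NC le u v (scanl mulg u s).
    by rewrite maximal_chain_labels // e sT lastE e sE mulKVg eqxx.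
  exists (Bseq (maximal_chain_size uN chain)); last by rewrite /= e.
  by rewrite mem_enum !inE /= chain fallE e.
rewrite mem_enum !inE maximal_chain_labels // fallE => /andP[/andP[pT /eqP pv]
  dp] ->.
by rewrite /F prod_edge_labels pv eqxx.
Qed.

End RisingLabeling.

(** * Products of reflections and the Euler form *)

Section Reflections.

Variables (R : realType) (l : nat).
Implicit Types (a b v x y z : 'cV[R]_l) (M G : 'M[R]_l) (s p : seq 'cV[R]_l).

Lemma dotC x y : dot x y = dot y x.
Proof. by rewrite /dot -[in RHS](trmxK (y^T *m x)) trmx_mul trmxK [RHS]mxE. Qed.

Lemma dotDr x y z : dot x (y + z) = dot x y + dot x z.
Proof. by rewrite /dot mulmxDr mxE. Qed.

Lemma dotZr k x y : dot x (k *: y) = k * dot x y.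
Proof. by rewrite /dot -scalemxAr mxE. Qed.

Lemma dotNr x y : dot x (- y) = - dot x y.
Proof. by rewrite -scaleN1r dotZr mulN1r. Qed.

Lemma dotBr x y z : dot x (y - z) = dot x y - dot x z.
Proof. by rewrite dotDr dotNr. Qed.

Lemma dot0r x : dot x 0 = 0.
Proof. by rewrite -(scale0r 0) dotZr mul0r. Qed.

Lemma dot_sumr I (r : seq I) (P : pred I) (F : I -> 'cV[R]_l) x :
  dot x (\sum_(i <- r | P i) F i) = \sum_(i <- r | P i) dot x (F i).
Proof.
by elim/big_rec2: _ => [|i y y' _ <-]; rewrite ?dot0r // dotDr.
Qed.

Lemma dotDl x y z : dot (x + y) z = dot x z + dot y z.
Proof. by rewrite dotC dotDr !(dotC z). Qed.

Lemma dotZl k x y : dot (k *: x) y = k * dot x y.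
Proof. by rewrite dotC dotZr dotC. Qed.

Lemma dotNl x y : dot (- x) y = - dot x y.
Proof. by rewrite dotC dotNr dotC. Qed.

Lemma dotBl x y z : dot (x - y) z = dot x z - dot y z.
Proof. by rewrite dotDl dotNl. Qed.

Lemma dot_eq0 x : (dot x x == 0) = (x == 0).
Proof.
apply/eqP/eqP => [|->]; last by rewrite dot0r.
rewrite /dot mxE => /eqP; rewrite psumr_eq0; last first.
  by move=> i _; rewrite mxE -expr2 sqr_ge0.
move=> /allP x0; apply/colP => i; rewrite mxE.
by have := x0 i; rewrite mem_index_enum mxE -expr2 sqrf_eq0 => /(_ isT) /eqP.
Qed.

Lemma dot_mull M x y : dot (M *m x) y = dot x (M^T *m y).
Proof. by rewrite /dot trmx_mul mulmxA. Qed.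

Lemma dot_orth M x y : M^T *m M = 1%:M -> dot (M *m x) (M *m y) = dot x y.
Proof. by move=> oM; rewrite dot_mull mulmxA oM mul1mx. Qed.

Lemma refl_mxE a x : refl_mx a *m x = x - (2 * dot a x / dot a a) *: a.
Proof.
rewrite /refl_mx mulmxBl mul1mx -scalemxAl -mulmxA.
rewrite [a^T *m x]mx11_scalar -/(dot a x) mul_mx_scalar scalerA.
by congr (_ - _ *: _); rewrite mulrAC.
Qed.

Lemma refl_mxZ k a : k != 0 -> refl_mx (k *: a) = refl_mx a.
Proof.
move=> k0; rewrite /refl_mx; congr (_ - _).
rewrite dotZl dotZr linearZ /= -scalemxAl -scalemxAr !scalerA.
have [->|a0] := eqVneq a 0; first by rewrite mul0mx !scaler0.
congr (_ *: _); have : dot a a != 0 by rewrite dot_eq0.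
by move=> d0; field; rewrite d0 k0.
Qed.

Lemma refl_mxN a : refl_mx (- a) = refl_mx a.
Proof. by rewrite -scaleN1r refl_mxZ // oppr_eq0 oner_eq0. Qed.

Lemma refl_mx_self a : a != 0 -> refl_mx a *m a = - a.
Proof.
move=> a0; rewrite refl_mxE mulfK ?dot_eq0 //.
by rewrite scaler_nat mulr2n opprD addrA subrr sub0r.
Qed.

Lemma refl_mx_fix a x : dot a x = 0 -> refl_mx a *m x = x.
Proof. by move=> ax; rewrite refl_mxE ax mulr0 mul0r scale0r subr0. Qed.

Lemma refl_mx_tr a : (refl_mx a)^T = refl_mx a.
Proof. by rewrite /refl_mx linearB linearZ /= trmx1 trmx_mul trmxK. Qed.

Lemma refl_mx_sqr a : refl_mx a *m refl_mx a = 1%:M.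
Proof.
have [->|a0] := eqVneq a 0.
  by rewrite /refl_mx mul0mx scaler0 subr0 mulmx1.
rewrite {2}/refl_mx mulmxBr mulmx1 -scalemxAr mulmxA refl_mx_self //.
by rewrite mulNmx scalerN opprK /refl_mx subrK.
Qed.

Lemma refl_mx_conj M a : M^T *m M = 1%:M ->
  M *m refl_mx a *m M^T = refl_mx (M *m a).
Proof.
move=> oM; have oM' : M *m M^T = 1%:M by apply: mulmx1C.
rewrite /refl_mx dot_orth // mulmxBr mulmxBl mulmx1 oM'.
by rewrite -scalemxAr -scalemxAl trmx_mul !mulmxA.
Qed.

Definition refl_prod s : 'M[R]_l := foldr (fun a M => refl_mx a *m M) 1%:M s.

Lemma refl_prod_cat s p : refl_prod (s ++ p) = refl_prod s *m refl_prod p.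
Proof. by elim: s => [|a s IHs] /=; rewrite ?mul1mx // IHs mulmxA. Qed.

Lemma refl_prod_orth s : (refl_prod s)^T *m refl_prod s = 1%:M.
Proof.
elim: s => [|a s IHs] /=; first by rewrite trmx1 mulmx1.
rewrite trmx_mul refl_mx_tr mulmxA -(mulmxA _ (refl_mx a) (refl_mx a)).
by rewrite refl_mx_sqr mulmx1.
Qed.

Lemma refl_prod_fix s v : (forall a, a \in s -> dot a v = 0) ->
  refl_prod s *m v = v.
Proof.
elim: s => [|a s IHs] sv /=; first by rewrite mul1mx.
rewrite -mulmxA IHs ?refl_mx_fix // => [|b bs]; apply: sv.
  exact: mem_head.
by rewrite inE bs orbT.
Qed.

(** The map [f] stays abstract in order to cover both [dot z] and the Euler form in its left
    argument. *)
Lemma refl_prod_linear (f : 'cV[R]_l -> R) s v :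
  (forall k x y, f (x - k *: y) = f x - k * f y) ->
  (forall a, a \in s -> f a = 0) -> f (refl_prod s *m v) = f v.
Proof.
move=> lf; elim: s => [|a s IHs] fs /=; first by rewrite mul1mx.
rewrite -mulmxA refl_mxE lf (fs a) ?mem_head // mulr0 subr0 IHs // => b bs.
by apply: fs; rewrite inE bs orbT.
Qed.

Lemma refl_prod_span s v : v - refl_prod s *m v \in <<s>>%VS.
Proof.
elim: s => [|a s IHs] /=; first by rewrite mul1mx subrr mem0v.
rewrite -mulmxA refl_mxE opprD opprK addrA memvD //.
  by apply: subvP (IHs); apply: sub_span => b bs; rewrite inE bs orbT.
by rewrite memvZ // memv_span // mem_head.
Qed.

(** With [w] the image of [v] under the tail, [v - w] is a multiple of [a] and lies in the span of
    the tail. Independence makes it zero, so [a] is orthogonal to [v] and the tail fixes [v]. *)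
Lemma refl_prod_fixed s v : free s -> refl_prod s *m v = v ->
  forall a, a \in s -> dot a v = 0.
Proof.
elim: s => //= a s IHs; rewrite free_cons => /andP[as' fs] sv.
pose w := refl_prod s *m v.
have vE : v = w - (2 * dot a w / dot a a) *: a.
  by rewrite -{1}sv -mulmxA refl_mxE.
have a0 : a != 0 by apply: contraNneq as' => ->; exact: mem0v.
have aw0 : dot a w = 0.
  apply: contraNeq as' => aw.
  have -> : a = (- (2 * dot a w / dot a a))^-1 *: (v - w).
    have e : - (2 * dot a w / dot a a) != 0.
      by rewrite oppr_eq0 !mulf_eq0 invr_eq0 dot_eq0 !negb_or aw a0 pnatr_eq0.
    by rewrite {1}vE addrAC subrr add0r -scaleNr scalerA mulVf // scale1r.
  by rewrite memvZ // refl_prod_span.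
have vw : v = w by rewrite vE aw0 mulr0 mul0r scale0r subr0.
move=> b; rewrite inE => /predU1P[->|bs]; first by rewrite vw.
by apply: IHs => //; rewrite -/w -vw.
Qed.

Definition orthonormal s :=
  pairwise (fun a b => dot a b == 0) s && all (fun a => dot a a == 1) s.

Lemma refl_prod_orthonormal s : orthonormal s ->
  refl_prod s = 1%:M - 2 *: \sum_(a <- s) a *m a^T.
Proof.
elim: s => [|a s IHs]; first by rewrite big_nil scaler0 subr0.
rewrite /orthonormal /= => /andP[/andP[as0 ps] /andP[/eqP a1 s1]].
rewrite IHs ?/orthonormal ?ps // big_cons scalerDr opprD addrA.
rewrite mulmxBr mulmx1 /refl_mx a1 divr1; congr (_ - _).
rewrite -scalemxAr mulmxBl mul1mx -scalemxAl mulmx_sumr.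
rewrite [X in _ - _ *: X]big1_seq ?scaler0 ?subr0 // => b /= bs.
rewrite -mulmxA (mulmxA _ b) [a^T *m b]mx11_scalar -/(dot a b).
by rewrite (eqP (allP as0 b bs)) raddf0 mul0mx mulmx0.
Qed.

Lemma refl_prod_orthonormal_tr s : orthonormal s -> (refl_prod s)^T =
  refl_prod s.
Proof.
move=> os; rewrite refl_prod_orthonormal // linearB linearZ /= trmx1 linear_sum.
by congr (_ - _ *: _); apply: eq_bigr => a _; rewrite /= trmx_mul trmxK.
Qed.

Lemma refl_prod_orthonormal_sqr s : orthonormal s ->
  refl_prod s *m refl_prod s = 1%:M.
Proof. by move=> os; rewrite -{1}refl_prod_orthonormal_tr ?refl_prod_orth. Qed.

Lemma refl_prod_orthonormal_trace s : orthonormal s ->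
  \tr (refl_prod s) = l%:R - 2 * (size s)%:R.
Proof.
move=> os; rewrite refl_prod_orthonormal // linearB linearZ /= mxtrace1
  linear_sum.
case/andP: os => _ /allP os; rewrite big_seq.
rewrite (eq_bigr (fun=> 1)) => [|a /os /eqP a1]; last first.
  by rewrite /= mxtrace_mulC -a1 /mxtrace big_ord1.
by rewrite -big_seq big_tnth sumr_const card_ord.
Qed.

Lemma refl_prod_orthonormal_opp s a : orthonormal s -> a \in s ->
  refl_prod s *m a = - a.
Proof.
case/andP => ps us /splitPr sE; case: sE ps us => p q.
rewrite pairwise_cat /= => /and3P[/allrelP pa _ /andP[/allP aq _]].
rewrite all_cat /= => /and3P[_ /eqP a1 _].
have a0 : a != 0.
  by apply: contra_eq_neq a1 => ->; rewrite dot0r eq_sym oner_eq0.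
rewrite refl_prod_cat -mulmxA /= -mulmxA [refl_prod q *m a]refl_prod_fix.
  rewrite refl_mx_self // mulmxN refl_prod_fix // => b bp.
  by apply/eqP/pa; rewrite // mem_head.
by move=> b /aq /eqP; rewrite dotC.
Qed.

Lemma orthonormal_take s j : orthonormal s -> (j < size s)%N ->
  refl_prod (take j s) *m s`_j = s`_j.
Proof.
move=> os js; apply: refl_prod_fix => a; case/andP: os => ps _.
move: ps; rewrite -{1}(cat_take_drop j s) (drop_nth 0) // pairwise_cat.
by case/and3P => /allrelP h _ _ aj; apply/eqP/h; rewrite // mem_head.
Qed.

Lemma unitmx_ker M : (forall v, M *m v = 0 -> v = 0) -> M \in unitmx.
Proof.
move=> kM; rewrite -unitmx_tr -row_free_unit -kermx_eq0.
apply/eqP/row_matrixP => i; rewrite row0; apply: trmx_inj; rewrite trmx0.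
apply: kM; rewrite -{1}[M]trmxK -trmx_mul -row_mul mulmx_ker.
by rewrite row0 trmx0.
Qed.

Definition fixpoint_free G := forall v, G *m v = v -> v = 0.

Lemma fixpoint_free_unit G : fixpoint_free G -> 1%:M - G \in unitmx.
Proof.
move=> fG; apply: unitmx_ker => v; rewrite mulmxBl mul1mx => /eqP.
by rewrite subr_eq0 => /eqP e; apply: fG.
Qed.

(** A vector orthogonal to all of [s] is fixed by the product, hence zero. So the matrix with rows
    [s] is invertible, and the columns of its inverse are the dual basis. *)
Lemma refl_prod_dual s : size s = l -> fixpoint_free (refl_prod s) ->
  exists2 z : 'I_l -> 'cV[R]_l,
    forall i j : 'I_l, dot (z i) s`_j = (i == j)%:R &
    forall y, y = \sum_i dot (z i) y *: s`_i.
Proof.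
move=> sz ff; pose S : 'M[R]_l := \matrix_(i, j) s`_i j 0.
have rowS i : row i S = (s`_i)^T by apply/rowP => j; rewrite !mxE.
have uS : S \in unitmx.
  apply: unitmx_ker => v Sv; apply: ff; apply: refl_prod_fix => a.
  move=> /(nthP 0)[i ilt <-]; rewrite sz in ilt.
  have := congr1 (fun u : 'cV[R]_l => u (Ordinal ilt) 0) Sv.
  by rewrite [RHS]mxE => <-; rewrite /dot -(rowS (Ordinal ilt)) -row_mul mxE.
exists (fun i => col i (invmx S)) => [i j|y].
  have := congr1 (fun M => M j i) (mulmxV uS); rewrite [RHS]mxE eq_sym => <-.
  rewrite dotC /dot -rowS !mxE; apply: eq_bigr => k _; by rewrite !mxE.
have := congr1 (mulmx^~ y) (mulmxV (_ : S^T \in unitmx)).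
rewrite unitmx_tr uS mul1mx => /(_ isT) => {1}<-.
apply/colP => k; rewrite -mulmxA mxE summxE; apply: eq_bigr => i _.
rewrite !mxE mulrC; congr (_ * _).
rewrite -trmx_inv /dot !mxE; apply: eq_bigr => j _; by rewrite !mxE.
Qed.

Lemma refl_prod_free s : size s = l -> fixpoint_free (refl_prod s) -> free s.
Proof.
move=> sz ff; have [z zs _] := refl_prod_dual sz ff.
apply/(@freeP _ _ _ (in_tuple s)) => k k0 i.
have il : (i < l)%N by rewrite -[X in (_ < X)%N]sz.
have := congr1 (dot (z (Ordinal il))) k0; rewrite dot_sumr dot0r (bigD1 i) //=.
have -> : s`_i = s`_(Ordinal il) by [].
rewrite dotZr zs eqxx mulr1 big1 ?addr0 // => j ji.
have jl : (j < l)%N by rewrite -[X in (_ < X)%N]sz.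
rewrite dotZr (zs _ (Ordinal jl)) -val_eqE /= eq_sym.
by rewrite (_ : (j == i :> nat) = false) ?mulr0 //; apply/negbTE.
Qed.

(* The Euler (Seifert) form of [G]; it satisfies
   [euler G x y + euler G y x = 2 * dot x y] when [G] is orthogonal. *)
Definition euler G x y : R := dot ((2 *: invmx (1%:M - G)) *m x) y.

Lemma eulerBZl G y k x x' :
  euler G (x - k *: x') y = euler G x y - k * euler G x' y.
Proof. by rewrite /euler mulmxBr -scalemxAr dotBl dotZl. Qed.

Lemma eulerZr G x k y : euler G x (k *: y) = k * euler G x y.
Proof. exact: dotZr. Qed.

Lemma euler_sumr G x I (r : seq I) (P : pred I) (F : I -> 'cV[R]_l) :
  euler G x (\sum_(i <- r | P i) F i) = \sum_(i <- r | P i) euler G x (F i).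
Proof. exact: dot_sumr. Qed.

Section Form.

Variable G : 'M[R]_l.
Hypothesis ffG : fixpoint_free G.

Lemma euler_subl x y : euler G (x - G *m x) y = 2 * dot x y.
Proof.
rewrite /euler -scalemxAl dotZl; congr (_ * dot _ _).
by rewrite -{1}(mul1mx x) -mulmxBl mulKmx // fixpoint_free_unit.
Qed.

Lemma euler_serre x y : G^T *m G = 1%:M -> euler G x y = - euler G (G *m y) x.
Proof.
move=> oG; have uG := fixpoint_free_unit ffG.
(* As [1 - G] is invertible, every vector has this shape, on which the form is explicit. *)
have subE z : exists q, z = q - G *m q.
  exists (invmx (1%:M - G) *m z); rewrite -{1}(mul1mx (invmx _ *m _)) -mulmxBl.
  by rewrite mulKVmx.
have [p' ->] := subE x; have [q ->] := subE y.
rewrite mulmxBr !euler_subl !dotBr dot_orth //.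
by rewrite [dot q p']dotC [dot (G *m q) p']dotC; ring.
Qed.

Lemma euler_inv x y : G^T *m G = 1%:M -> euler G (G *m x) (G *m y) = euler G x
  y.
Proof. by move=> oG;
  rewrite [RHS]euler_serre // [in RHS]euler_serre // opprK. Qed.

(** Reflections after position [i] fix [z i], the [i]-th subtracts twice its root, and those before
    it move only that root. Hence [z i - G *m z i] is twice the left argument, and [euler_subl]
    applies. *)
Lemma euler_refl_prod s (z : 'I_l -> 'cV[R]_l) (i : 'I_l) y :
  G = refl_prod s -> size s = l ->
  (forall i j : 'I_l, dot (z i) s`_j = (i == j)%:R) -> dot s`_i s`_i = 1 ->
  euler G (refl_prod (take i s) *m s`_i) y = dot (z i) y.
Proof.
move=> GE sz zs s1; have ilt : (i < size s)%N by rewrite sz.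
have fz j : (j < size s)%N -> j != i -> dot s`_j (z i) = 0.
  rewrite {1}sz => jl ne; rewrite dotC (zs i (Ordinal jl)) -val_eqE /= eq_sym.
  by rewrite (negbTE ne).
have : z i - G *m z i = 2 *: (refl_prod (take i s) *m s`_i).
  have sE : s = take i s ++ s`_i :: drop i.+1 s by rewrite -drop_nth //
    cat_take_drop.
  rewrite GE [in LHS]sE refl_prod_cat /=.
  rewrite -mulmxA -(mulmxA (refl_mx _)).
  rewrite [refl_prod (drop _ _) *m _]refl_prod_fix; last first.
    move=> a /(nthP 0)[j]; rewrite size_drop nth_drop => jlt <-.
    by apply: fz; [rewrite -ltn_subRL | rewrite gtn_eqF // ltnS leq_addr].
  rewrite refl_mxE s1 dotC zs eqxx divr1 mulr1 mulmxBr -scalemxAr.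
  rewrite [_ *m z i]refl_prod_fix ?subKr // => a /(nthP 0)[j].
  rewrite size_take ilt => jlt <-; rewrite nth_take //; apply: fz;
    first exact: ltn_trans jlt ilt.
  by rewrite ltn_eqF.
move=> /(congr1 (fun v => euler G v y)); rewrite euler_subl.
rewrite -[2 *: _]opprK -scaleNr -sub0r eulerBZl.
have -> : euler G 0 y = 0 by rewrite /euler mulmx0 dotC dot0r.
by lra.
Qed.

(** By induction the form against the [j]-th vector vanishes on all entries before [i], so the
    prefix of reflections in [euler_refl_prod] does not change its value, and a dual coordinate
    remains. *)
Lemma euler_exceptional s (i j : 'I_l) : G = refl_prod s -> size s = l ->
  (forall a, a \in s -> dot a a = 1) -> (i <= j)%N ->
  euler G s`_i s`_j = (i == j)%:R.
Proof.
move=> GE sz s1; have [|z zs _] := refl_prod_dual sz; first by rewrite -GE.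
move: {2}(nat_of_ord i) (leqnn i) => n; elim: n i j => [|n IHn] i j le_in le_ij.
  rewrite -zs -(euler_refl_prod _ GE sz zs) ?s1 ?mem_nth ?sz //.
  by move: le_in; rewrite leqn0 => /eqP ->; rewrite take0 mul1mx.
rewrite -zs -(euler_refl_prod _ GE sz zs) ?s1 ?mem_nth ?sz //.
apply/esym/(@refl_prod_linear (fun x => euler G x s`_j)) => [k x y|].
  exact: eulerBZl.
move=> a /(nthP 0)[q]; rewrite size_take sz ltn_ord => qi <-;
  rewrite nth_take //.
have ql := ltn_trans qi (ltn_ord i).
rewrite (IHn (Ordinal ql) j) /=; try lia.
by rewrite -val_eqE /= (_ : (q == j) = false) //; apply/eqP; lia.
Qed.

End Form.

(** Forward substitution: pairing the [i]-th vector with [y] gives [c i] plus products of earlier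
    coefficients with form values. These products are nonnegative by induction, so [c i] is at most
    the pairing. *)
Lemma coef_le0 G s (c : 'I_l -> R) y :
  y = \sum_i c i *: s`_i ->
  (forall i j : 'I_l, (i <= j)%N -> euler G s`_i s`_j = (i == j)%:R) ->
  (forall i : 'I_l, c i = 0 \/ euler G s`_i y <= 0 /\
     forall j : 'I_l, (j < i)%N -> c j = 0 \/ euler G s`_i s`_j <= 0) ->
  forall i, c i <= 0.
Proof.
move=> yE exc cs i; move: {2}(nat_of_ord i) (leqnn i) => n.
elim: n i => [|n IHn] i le_in; have [->//|[]] := cs i;
  rewrite yE euler_sumr (bigD1 i) //= eulerZr exc // eqxx mulr1 => s0 sj.
- apply: le_trans s0; rewrite lerDl sumr_ge0 // => j ne; rewrite eulerZr exc;
    last lia.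
  by rewrite eq_sym (negbTE ne) mulr0.
- apply: le_trans s0; rewrite lerDl sumr_ge0 // => j ne; rewrite eulerZr.
  have [le_ij|lt_ji] := leqP i j.
    by rewrite exc // eq_sym (negbTE ne) mulr0.
  have [->|e] := sj j lt_ji; first by rewrite mul0r.
  by rewrite mulr_le0 // IHn //; lia.
Qed.

End Reflections.

Lemma nth_map_iota (X : Type) (x0 : X) (F : nat -> X) N n :
  (n < N)%N -> nth x0 (map F (iota 0 N)) n = F n.
Proof. by move=> nN; rewrite (nth_map 0%N) ?size_iota // nth_iota. Qed.

Lemma index_first (X : eqType) (x0 x : X) s n : (n < size s)%N -> nth x0 s n =
  x ->
  (forall m, (m < n)%N -> nth x0 s m != x) -> index x s = n.
Proof.
move=> ns sn first_n; case: (ltngtP (index x s) n) => // [lt_in|lt_ni].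
  by have := first_n _ lt_in; rewrite nth_index ?eqxx // -sn mem_nth.
by have := before_find x0 lt_ni; rewrite sn /= eqxx.
Qed.

(** * Roots and simple reflections *)

Section RootSystem.

Variables (R : realType) (gT : finGroupType) (W : {group gT}) (l : nat).
Variable rW : mx_representation R W l.
Variables (Phi Pos : 'cV[R]_l -> Prop) (sigma : l.-tuple 'cV[R]_l).
Hypotheses (hW : real_reflection_group rW) (hPhi : root_system rW Phi).
Hypotheses (hPos : positive_system Phi Pos) (hsigma : simple_system Phi sigma).
Hypothesis hsigmaPos : forall i, Pos (tnth sigma i).

Local Notation T := (reflections rW).
Local Notation g := (coxeter_elt rW sigma).

Lemma repr_orth w : w \in W -> (rW w)^T *m rW w = 1%:M.
Proof. by have [_ oW _] := hW; exact: oW. Qed.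

Lemma repr_inj : {in W &, injective rW}.
Proof. by have [fW _ _] := hW; exact: mx_faithful_inj. Qed.

Lemma gen_reflections : <<T>>%g = W.
Proof. by have [_ _ ->] := hW. Qed.

Lemma reflections_W t : t \in T -> t \in W.
Proof. by rewrite inE => /andP[]. Qed.

Lemma reflectionsP t :
  reflect (t \in W /\ exists2 a : 'cV[R]_l, a != 0 & rW t = refl_mx a) (t \in
    T).
Proof. by rewrite inE; apply: (iffP andP) => -[tW /asboolP]. Qed.

Lemma reflections_invol t : t \in T -> (t * t = 1)%g.
Proof.
case/reflectionsP => tW [a _ ta]; apply: repr_inj; rewrite ?groupM ?group1 //.
by rewrite repr_mxM // ta refl_mx_sqr repr_mx1.
Qed.

Lemma reflections_conj s t : s \in T -> t \in T -> (s ^ t)%g \in T.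
Proof.
case/reflectionsP => sW [a a0 sa] tT; have tW := reflections_W tT.
apply/reflectionsP; split; first by rewrite groupJ.
have tV : (t^-1 = t)%g by apply/eqP; rewrite eq_invg_mul reflections_invol.
have tt : rW t *m rW t = 1%:M by rewrite -repr_mxM // reflections_invol //
  repr_mx1.
have tr : (rW t)^T = rW t.
  by rewrite -[RHS]mul1mx -(repr_orth tW) -mulmxA tt mulmx1.
exists (rW t *m a).
  by apply: contraNneq a0 => ta; rewrite -(mul1mx a) -tt -mulmxA ta mulmx0.
by rewrite conjgE tV !repr_mxM ?groupM // sa -refl_mx_conj ?repr_orth // tr
  mulmxA.
Qed.

Lemma root_neq0 a : Phi a -> a != 0.
Proof. by have [h _ _] := hPhi; case/h. Qed.

Lemma root_reflP a : Phi a -> root_refl rW a \in T /\ rW (root_refl rW a) =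
  refl_mx a.
Proof.
move=> Pa; have [h _ _] := hPhi; have [a0 [t tT ta]] := h a Pa.
rewrite /root_refl; case: pickP => [w /andP[wW /eqP wa]|/(_ t)] /=.
  by split=> //; apply/reflectionsP; split=> //; exists a.
by rewrite reflections_W // ta eqxx.
Qed.

Lemma root_refl_W a : Phi a -> root_refl rW a \in W.
Proof. by case/root_reflP => /reflections_W. Qed.

Lemma root_act w a : w \in W -> Phi a -> Phi (rW w *m a).
Proof. by have [_ _] := hPhi; apply. Qed.

Lemma root_opp a : Phi a -> Phi (- a).
Proof.
move=> Pa; rewrite -refl_mx_self ?root_neq0 //; have [_ <-] := root_reflP Pa.
exact: root_act (root_refl_W Pa) Pa.
Qed.

Lemma root_refl_eq a b : Phi a -> Phi b -> refl_mx a = refl_mx b ->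
  a = b \/ a = - b.
Proof.
move=> Pa Pb ab; have [h1 h2 _] := hPhi.
have [_ [t tT ta]] := h1 a Pa; have [e _ he] := h2 t tT.
have /he ae : Phi a /\ rW t = refl_mx a by [].
have /he be : Phi b /\ rW t = refl_mx b by rewrite -ab.
by case: ae be => -> [] ->; rewrite ?opprK; auto.
Qed.

Lemma posP a : Pos a -> Phi a.
Proof. by have [c [_ h]] := hPos; case/h. Qed.

Lemma pos_functional : exists c, [/\ forall a, Pos a -> 0 < dot c a,
  forall a, Phi a -> 0 < dot c a -> Pos a & forall a, Phi a -> dot c a != 0].
Proof.
have [c [h0 h]] := hPos; exists c; split=> // a; first by case/h.
by move=> Pa ca; apply/h.
Qed.

Lemma pos_opp a : Phi a -> ~ Pos a <-> Pos (- a).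
Proof.
have [c [h1 h2 h3]] := pos_functional; move=> Pa; split=> [nP|/h1].
  apply: (h2 (- a)); first exact: root_opp.
  have := h3 a Pa; rewrite dotNr oppr_gt0 lt_neqAle => ->.
  by rewrite leNgt; apply/negP => /(h2 _ Pa).
by rewrite dotNr => c1 /h1; lra.
Qed.

Lemma pos_notopp a : Pos a -> ~ Pos (- a).
Proof. by move=> Pa; rewrite -pos_opp; [move=> h; apply: h|exact: posP]. Qed.

Lemma simple_root i : Phi (tnth sigma i).
Proof. exact: posP. Qed.

Lemma simple_mem a : a \in (sigma : seq _) -> Pos a.
Proof. by case/tnthP => i ->. Qed.

Lemma pos_coef a : Pos a ->
  exists2 k : 'I_l -> R, a = \sum_i k i *: tnth sigma i & forall i, 0 <= k i.
Proof.
move=> Pa; have [_ _ h] := hsigma; have [k ak [kp|kn]] := h a (posP Pa).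
  by exists k.
have [c [hc _ _]] := pos_functional; have ca := hc a Pa.
have : dot c a <= 0.
  rewrite ak dot_sumr sumr_le0 // => i _; rewrite dotZr mulr_le0_ge0 //.
  exact/ltW/hc.
by rewrite leNgt ca.
Qed.

Lemma coef_pos a (k : 'I_l -> R) i : Phi a -> a = \sum_i k i *: tnth sigma i ->
  0 < k i -> Pos a.
Proof.
move=> Pa ak ki; have [_ fs h] := hsigma.
have [k' ak' [kp|kn]] := h a Pa.
  have [c [h1 h2 h3]] := pos_functional; apply: (h2 a Pa).
  rewrite lt_neqAle eq_sym (h3 a Pa) ak' dot_sumr sumr_ge0 // => j _.
  by rewrite dotZr mulr_ge0 //; apply/ltW/h1.
have : \sum_i (k i - k' i) *: sigma`_i = 0.
  under eq_bigr do rewrite scalerBl; rewrite big_split /= sumrN.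
  apply/eqP; rewrite subr_eq0; apply/eqP.
  transitivity a; [rewrite ak|rewrite ak'];
    by apply: eq_bigr => j _; rewrite (tnth_nth 0).
move=> /(elimT freeP fs)/(_ i)/eqP; rewrite subr_eq0 => /eqP e.
by have := kn i; rewrite -e leNgt ki.
Qed.

(** Only the [i]-th coordinate changes, so any other nonzero coordinate stays positive. If there is
    none, [a] is a multiple of the simple root, hence equal to it, as each reflection has a single
    pair of roots. *)
Lemma pos_simple_refl a i : Pos a -> a <> tnth sigma i ->
  Pos (refl_mx (tnth sigma i) *m a).
Proof.
move=> Pa ai; have [k ak kp] := pos_coef Pa.
have Pra : Phi (refl_mx (tnth sigma i) *m a).
  have [_ <-] := root_reflP (simple_root i).
  exact: root_act (root_refl_W (simple_root i)) (posP Pa).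
case: (pickP (fun j => (j != i) && (k j != 0))) => [j /andP[ji kj]|none].
  set d := 2 * dot (tnth sigma i) a / dot (tnth sigma i) (tnth sigma i).
  apply: (@coef_pos _ (fun j => if j == i then k i - d else k j) j) => //.
    rewrite refl_mxE -/d [in LHS]ak (bigD1 i) //= [RHS](bigD1 i) //= eqxx
      scalerBl.
    rewrite addrAC; congr (_ + _); apply: eq_bigr => q /negbTE ->; by [].
  by rewrite (negbTE ji) lt_neqAle eq_sym kj kp.
have aE : a = k i *: tnth sigma i.
  rewrite {1}ak (bigD1 i) //= big1 ?addr0 // => j ji.
  by have /negbT := none j; rewrite ji negbK => /eqP ->; rewrite scale0r.
have ki : k i != 0.
  by apply: contraTneq (root_neq0 (posP Pa)); rewrite aE => ->;
    rewrite scale0r eqxx.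
have : refl_mx a = refl_mx (tnth sigma i) by rewrite aE refl_mxZ.
case/(root_refl_eq (posP Pa) (simple_root i)) => // e.
by case: (@pos_notopp (tnth sigma i)) => //; rewrite -e.
Qed.

(** The transpose applies the letters of [p] from the left end, and positivity can be lost only when
    the current root is the letter being applied. *)
Lemma pos_simple_prod p a : (forall b, b \in p -> b \in (sigma : seq _)) ->
  Pos a -> ~ Pos ((refl_prod p)^T *m a) ->
  exists2 j, (j < size p)%N & a = refl_prod (take j p) *m p`_j.
Proof.
elim: p a => [|b p IHp] a ps Pa /=; first by rewrite trmx1 mul1mx.
rewrite trmx_mul refl_mx_tr -mulmxA => nP.
have [->|ab] := eqVneq a b; first by exists 0%N; rewrite //= mul1mx.
have /tnthP[i bi] := ps b (mem_head _ _).
have [||j jp e] := IHp _ _ _ nP.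
- by move=> e ep; apply: ps; rewrite inE ep orbT.
- by rewrite bi; apply: pos_simple_refl => //; rewrite -bi; apply/eqP.
exists j.+1 => //=; rewrite -mulmxA -e mulmxA refl_mx_sqr mul1mx //.
Qed.

Lemma repr_refl_prod s : (forall a, a \in s -> Phi a) ->
  (\prod_(a <- s) root_refl rW a)%g \in W /\
  rW (\prod_(a <- s) root_refl rW a)%g = refl_prod s.
Proof.
elim: s => [|a s IHs] sP; first by rewrite big_nil group1 repr_mx1.
have [|sW sE] := IHs; first by move=> b bs; apply: sP; rewrite inE bs orbT.
have Pa := sP a (mem_head _ _); have aW := root_refl_W Pa.
by rewrite big_cons groupM // repr_mxM // sE /=; have [_ ->] := root_reflP Pa.
Qed.

Lemma coxeter_W : g \in W.
Proof. by have [] := @repr_refl_prod sigma (fun a h => posP (simple_mem h)).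
  Qed.

Lemma coxeterE : rW g = refl_prod sigma.
Proof. by have [] := @repr_refl_prod sigma (fun a h => posP (simple_mem h)).
  Qed.

Lemma coxeter_fixpoint_free : fixpoint_free (refl_prod sigma).
Proof.
move=> v gv; have [_ fs _] := hsigma.
have bs : basis_of fullv sigma.
  by rewrite basisEfree fs subvf dimvf size_tuple dim_matrix mulr1 leqnn.
have sv := refl_prod_fixed fs gv.
apply/eqP; rewrite -dot_eq0 {1}(coord_basis bs (memvf v)); apply/eqP.
rewrite dotC dot_sumr big1 // => i _; rewrite dotZr dotC sv ?mulr0 //.
by rewrite mem_nth // size_tuple.
Qed.

Lemma repr_coxeterX_inv m x y :
  euler (refl_prod sigma) (rW (g ^+ m)%g *m x) (rW (g ^+ m)%g *m y) =
  euler (refl_prod sigma) x y.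
Proof.
have gW := coxeter_W; elim: m => [|m IHm]; first by rewrite repr_mx1 !mul1mx.
rewrite expgS repr_mxM ?groupX // -!mulmxA coxeterE euler_inv //.
  exact: coxeter_fixpoint_free.
by rewrite -coxeterE repr_orth.
Qed.

Lemma rho_lt j : (j < l)%N ->
  rho rW sigma j = refl_prod (take j sigma) *m sigma`_j.
Proof.
move=> jl; rewrite /rho /cyclic_simple modn_small //; congr (_ *m _).
have [|_ <-] := @repr_refl_prod (take j sigma).
  by move=> a /mem_take /simple_mem /posP.
rewrite (big_nth 0) big_mkord size_take size_tuple jl; congr (rW _).
by apply: eq_bigr => i _; rewrite nth_take // modn_small // (ltn_trans _ jl).
Qed.

Lemma cyclic_simple_root j : (0 < l)%N -> Phi (cyclic_simple sigma j).
Proof.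
move=> l0; apply/posP/simple_mem; rewrite /cyclic_simple mem_nth //.
by rewrite size_tuple ltn_mod.
Qed.

Lemma rho_add n : (0 < l)%N -> rho rW sigma (l + n) = rW g *m rho rW sigma n.
Proof.
move=> l0; have cycW j := root_refl_W (cyclic_simple_root j l0).
have cycE i : cyclic_simple sigma (l + i) = cyclic_simple sigma i.
  by rewrite /cyclic_simple modnDl.
rewrite /rho cycE mulmxA; congr (_ *m _).
rewrite -repr_mxM ?coxeter_W ?group_prod // big_split_ord /=.
congr (rW (_ * _)%g); last by apply: eq_bigr => i _; rewrite cycE.
rewrite /coxeter_elt (big_nth 0) size_tuple big_mkord; apply: eq_bigr => i _.
by rewrite /cyclic_simple modn_small.
Qed.

Lemma rho_mul m j : (0 < l)%N ->
  rho rW sigma (j + m * l) = rW (g ^+ m)%g *m rho rW sigma j.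
Proof.
move=> l0; elim: m => [|m IHm]; first by rewrite addn0 repr_mx1 mul1mx.
rewrite mulSn addnCA rho_add // IHm mulmxA -repr_mxM ?expgS //.
  exact: coxeter_W.
by rewrite groupX // coxeter_W.
Qed.

End RootSystem.

(** * Bipartite Coxeter elements *)

Section Bipartite.

Variables (R : realType) (gT : finGroupType) (W : {group gT}) (l : nat).
Variable rW : mx_representation R W l.
Variables (Phi Pos : 'cV[R]_l -> Prop) (sigma : l.-tuple 'cV[R]_l) (r : nat).
Hypotheses (hW : real_reflection_group rW) (hPhi : root_system rW Phi).
Hypotheses (hPos : positive_system Phi Pos) (hsigma : simple_system Phi sigma).
Hypothesis hsigmaPos : forall i, Pos (tnth sigma i).
Hypothesis hr : (r <= l)%N.
Hypothesis horth1 : forall i j : 'I_l, (i < r)%N -> (j < r)%N ->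
  dot (tnth sigma i) (tnth sigma j) = (i == j)%:R.
Hypothesis horth2 : forall i j : 'I_l, (r <= i)%N -> (r <= j)%N ->
  dot (tnth sigma i) (tnth sigma j) = (i == j)%:R.

Local Notation T := (reflections rW).
Local Notation g := (coxeter_elt rW sigma).
Local Notation h := (coxeter_number rW sigma).
Local Notation rho := (rho rW sigma).

Definition part (b : bool) : seq 'cV[R]_l := if b then take r sigma else drop
  r sigma.
Definition part_refl b : 'M[R]_l := refl_prod (part b).

Lemma part_nth b a : a \in part b ->
  exists2 i : 'I_l, a = tnth sigma i & (i < r)%N = b.
Proof.
case: b => /(nthP 0)[i].
  rewrite size_takel ?size_tuple // => ir <-.
  rewrite nth_take //; exists (Ordinal (leq_trans ir hr)) => //.
  by rewrite (tnth_nth 0).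
rewrite size_drop size_tuple ltn_subRL => il <-.
exists (Ordinal il); first by rewrite (tnth_nth 0) nth_drop.
by rewrite /= ltnNge leq_addr.
Qed.

Lemma nth_part (i : 'I_l) : sigma`_i \in part (i < r)%N.
Proof.
have il := ltn_ord i; case: ltnP => ir.
  by rewrite -(nth_take 0 ir) mem_nth // size_takel ?size_tuple.
rewrite -{1}(subnKC ir) -nth_drop mem_nth // size_drop size_tuple.
by rewrite ltn_sub2r // (leq_ltn_trans ir).
Qed.

Lemma part_mem b a : a \in part b -> a \in (sigma : seq _).
Proof. by case/part_nth => i -> _; exact: mem_tnth. Qed.

Lemma simple_uniq : uniq sigma.
Proof. by have [_ /free_uniq] := hsigma. Qed.

Lemma part_disjoint b a : a \in part b -> a \notin part (~~ b).
Proof.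
case/part_nth => i -> ib; apply/negP => /part_nth[j e jb].
have ij : i = j by apply/val_inj/(uniqP 0 simple_uniq);
  rewrite /= ?inE ?size_tuple ?ltn_ord // -!tnth_nth.
by move: jb; rewrite -ij ib; case: (b).
Qed.

Lemma part_root b a : a \in part b -> Phi a.
Proof. by case/part_nth => i -> _; exact/(posP hPos). Qed.

Lemma part_pos b a : a \in part b -> Pos a.
Proof. by case/part_nth => i ->. Qed.

Lemma part_orthonormal b : orthonormal (part b).
Proof.
have dotE (i j : 'I_l) : (i < r)%N = (j < r)%N ->
    dot (tnth sigma i) (tnth sigma j) = (i == j)%:R.
  move=> ij; case: (ltnP i r) (ij) => ir.
    by move/esym=> jr; exact: horth1.
  by move/esym/negbT; rewrite -leqNgt => jr; exact: horth2.
apply/andP; split; last first.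
  by apply/allP => a /part_nth[i -> _]; rewrite dotE ?eqxx.
have up : uniq (part b).
  by case: b; rewrite /part ?take_uniq ?drop_uniq // simple_uniq.
apply/(pairwiseP 0) => i j; rewrite !inE => il jl ij.
have /part_nth[i' e ib] := mem_nth 0 il;
  have /part_nth[j' e' jb] := mem_nth 0 jl.
have [ij'|ne] := eqVneq i' j'; last by rewrite e e' dotE ?ib // (negbTE ne).
move: ij.
rewrite (_ : i = j) ?ltnn //; apply: (uniqP 0 up) => //.
by rewrite e e' ij'.
Qed.

Lemma part_refl_sqr b : part_refl b *m part_refl b = 1%:M.
Proof. exact/refl_prod_orthonormal_sqr/part_orthonormal. Qed.

Lemma part_reflK b (v : 'cV[R]_l) : part_refl b *m (part_refl b *m v) = v.
Proof. by rewrite mulmxA part_refl_sqr mul1mx. Qed.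

Lemma part_refl_opp b a : a \in part b -> part_refl b *m a = - a.
Proof. exact/refl_prod_orthonormal_opp/part_orthonormal. Qed.

(** The letters of a part are orthogonal, so the prefix in [pos_simple_prod] fixes the letter where
    positivity is lost. *)
Lemma part_refl_flip b a : Pos a -> ~ Pos (part_refl b *m a) -> a \in part b.
Proof.
move=> Pa; rewrite /part_refl -refl_prod_orthonormal_tr ?part_orthonormal //
  => nP.
have [|j jp ->] := pos_simple_prod hPhi hPos hsigma hsigmaPos _ Pa nP.
  by move=> e; exact: part_mem.
by rewrite orthonormal_take ?part_orthonormal // mem_nth.
Qed.

Lemma part_refl_W b : exists2 w, w \in W & rW w = part_refl b.
Proof.
have [|wW wE] := @repr_refl_prod _ _ _ _ _ _ hPhi (part b).
  by move=> a; exact: part_root.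
by eexists; first exact: wW.
Qed.

Lemma coxeter_part : rW g = part_refl true *m part_refl false.
Proof.
rewrite (coxeterE hPhi hPos hsigmaPos) /part_refl -refl_prod_cat.
by rewrite cat_take_drop.
Qed.

(* The first reflection applied is [part_refl b], and then the two parts
   alternate; two steps are one step of [g] or of its inverse. *)
Fixpoint alt (b : bool) (k : nat) (v : 'cV[R]_l) : 'cV[R]_l :=
  if k is k'.+1 then part_refl (b (+) odd k') *m alt b k' v else v.

Lemma altS b k v : alt b k.+1 v = part_refl (b (+) odd k) *m alt b k v.
Proof. by []. Qed.

Lemma alt_add b m k v : alt b (m + k) v = alt (b (+) odd m) k (alt b m v).
Proof.
elim: k => [|k IHk]; first by rewrite addn0.
by rewrite addnS /= IHk oddD addbA.
Qed.

Lemma altN b k v : alt b k (- v) = - alt b k v.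
Proof. by elim: k => //= k ->; rewrite mulmxN. Qed.

(* A sign change of the alternating orbit of a root is a centre of antisymmetry,
   so that all runs of constant sign of that orbit have the same length. *)
Lemma alt_antisym b q v : alt b q.+1 v = - alt b q v ->
  forall k, (k <= q)%N -> alt b (q.+1 + k) v = - alt b (q - k) v.
Proof.
move=> fl; elim=> [|k IHk] kq; first by rewrite addn0 subn0.
rewrite addnS altS IHk 1?ltnW //.
have -> : (q - k = (q - k.+1).+1)%N by lia.
rewrite altS mulmxN; congr (- _).
have -> : odd (q.+1 + k) = odd (q - k.+1).
  have -> : (q.+1 + k = (q - k.+1) + k.+1.*2)%N by lia.
  by rewrite oddD odd_double addbF.
by rewrite part_reflK.
Qed.

Lemma alt_flip b q v : Pos (alt b q v) -> ~ Pos (alt b q.+1 v) ->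
  alt b q v \in part (b (+) odd q) /\ alt b q.+1 v = - alt b q v.
Proof. by move=> P1 /(part_refl_flip P1) e; split=> //=;
  exact: part_refl_opp. Qed.

Lemma alt_false_double m v : alt false m.*2 v = rW (g ^+ m)%g *m v.
Proof.
have gW := coxeter_W hPhi hPos hsigmaPos.
elim: m => [|m IHm]; first by rewrite repr_mx1 mul1mx.
rewrite doubleS /= IHm odd_double /= !mulmxA -coxeter_part.
by rewrite -repr_mxM ?groupX // -expgS.
Qed.

Lemma alt_true_double m v : alt true m.*2 v = rW (g ^- m)%g *m v.
Proof.
have gW := coxeter_W hPhi hPos hsigmaPos.
have gV : part_refl false *m part_refl true = rW (g^-1)%g.
  rewrite repr_mxV // coxeter_part.
  have := part_refl_sqr true; have := part_refl_sqr false.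
  move=> c2 c1; have e : part_refl true *m part_refl false *m
      (part_refl false *m part_refl true) = 1%:M.
    by rewrite mulmxA -(mulmxA (part_refl true)) c2 mulmx1.
  have [u _] := mulmx1_unit e.
  by rewrite -[RHS]mulmx1 -e mulKmx.
elim: m => [|m IHm]; first by rewrite expg0 invg1 repr_mx1 mul1mx.
rewrite doubleS /= IHm odd_double /= !mulmxA gV.
by rewrite -repr_mxM ?groupV ?groupX // -!expgVn -expgS.
Qed.

Lemma alt_period b k v : alt b (h.*2 + k) v = alt b k v.
Proof.
rewrite alt_add odd_double addbF; congr alt.
case: b; rewrite ?alt_true_double ?alt_false_double expg_order ?invg1;
  by rewrite repr_mx1 mul1mx.
Qed.

(** * The enumeration of the positive roots *)

Lemma rho_true (i : 'I_l) : (i < r)%N -> rho i = sigma`_i.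
Proof.
move=> ir; rewrite (rho_lt hPhi hPos hsigmaPos) // -(nth_take 0 ir).
rewrite -[take i sigma](take_takel _ (ltnW ir)).
apply: orthonormal_take; first exact: (part_orthonormal true).
by rewrite size_takel ?size_tuple.
Qed.

Lemma rho_false (i : 'I_l) : (r <= i)%N -> rho i = part_refl true *m sigma`_i.
Proof.
move=> ri; rewrite (rho_lt hPhi hPos hsigmaPos) //.
have -> : take i sigma = take r sigma ++ take (i - r) (drop r sigma).
  rewrite -{1}(cat_take_drop r sigma) take_cat size_take size_tuple.
  have rl : (r < l)%N by apply: leq_ltn_trans ri _.
  by rewrite rl ltnNge ri.
have e : sigma`_i = (drop r sigma)`_(i - r) by rewrite nth_drop subnKC.
rewrite refl_prod_cat -mulmxA e orthonormal_take //.
  exact: (part_orthonormal false).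
by rewrite size_drop size_tuple ltn_sub2r // (leq_ltn_trans ri).
Qed.

Lemma rho_pos (i : 'I_l) : Pos (rho i).
Proof.
case: (ltnP i r) => ir; first by rewrite rho_true // -tnth_nth.
rewrite rho_false //; apply: contrapT => /(part_refl_flip _) e.
have := part_disjoint (e _); rewrite -tnth_nth => /(_ (hsigmaPos i)).
by have := nth_part i; rewrite ltnNge ir (tnth_nth 0) /= => ->.
Qed.

(** Each of the first [l] roots starts a positive stretch of its orbit under [g]; this separates
    their translates by different powers of [g]. *)
Lemma coxeterV_rho (i : 'I_l) : ~ Pos (rW (g^-1)%g *m rho i).
Proof.
have := alt_true_double 1 (rho i); rewrite expg1 => <-;
  rewrite [1.*2]/= !altS /=.
case: (ltnP i r) => ir.
  have ip : sigma`_i \in part true by have := nth_part i; rewrite ir.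
  rewrite rho_true // (part_refl_opp ip) mulmxN; apply: (pos_notopp hPhi hPos).
  apply: contrapT => /(part_refl_flip (part_pos ip)) /part_disjoint.
  by rewrite ip.
have ip : sigma`_i \in part false by have := nth_part i; rewrite ltnNge ir.
rewrite rho_false // part_reflK (part_refl_opp ip).
by apply: (pos_notopp hPhi hPos); exact: part_pos ip.
Qed.

Lemma rho_inj (i j : 'I_l) : rho i = rho j -> i = j.
Proof.
suff wlg (i' j' : 'I_l) : (i' < r)%N -> (r <= j')%N -> rho i' <> rho j'.
  move=> e; apply/val_inj/(uniqP 0 simple_uniq);
    rewrite /= ?inE ?size_tuple ?ltn_ord //.
  move: e; case: (ltnP i r) => ir; case: (ltnP j r) => jr.
  - by rewrite !rho_true.
  - by move/wlg; case.
  - by move/esym/wlg; case.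
  by rewrite !rho_false // => /(congr1 (mulmx (part_refl true)));
    rewrite !part_reflK.
move=> ir jr; rewrite rho_true // rho_false // => e.
have ip : sigma`_i' \in part true by have := nth_part i'; rewrite ir.
have := congr1 (mulmx (part_refl true)) e; rewrite part_reflK part_refl_opp //.
move=> e'; apply: (pos_notopp hPhi hPos (part_pos ip)).
by rewrite e' -tnth_nth.
Qed.

Lemma rho_norm (i : 'I_l) : dot (rho i) (rho i) = 1.
Proof.
have si : dot sigma`_i sigma`_i = 1.
  by case/andP: (part_orthonormal (i < r)%N) => _ /allP/(_ _ (nth_part i))/eqP.
case: (ltnP i r) => ir; first by rewrite rho_true.
by rewrite rho_false // dot_orth ?refl_prod_orth.
Qed.

(** Two involutions whose product has odd order are conjugate in the dihedral group they generate,
    so the traces [l - 2 * r] and [l - 2 * (l - r)] of the two parts agree. *)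
Lemma odd_coxeter_number : odd h -> l = r.*2.
Proof.
move=> oh; have gW := coxeter_W hPhi hPos hsigmaPos.
have hE : h = (h./2).*2.+1 by rewrite -[LHS]odd_double_half oh.
have [w1 w1W w1E] := part_refl_W true; have [w2 w2W w2E] := part_refl_W false.
have gE : g = (w1 * w2)%g.
  by apply: (repr_inj hW); rewrite ?groupM // repr_mxM // w1E w2E coxeter_part.
have sqr1 b w : w \in W -> rW w = part_refl b -> (w * w = 1)%g.
  move=> wW wE; apply: (repr_inj hW); rewrite ?groupM ?group1 //.
  by rewrite repr_mxM // wE part_refl_sqr repr_mx1.
have w1V : (w1^-1 = w1)%g by apply/eqP; rewrite eq_invg_mul (sqr1 true).
have w2V : (w2^-1 = w2)%g by apply/eqP; rewrite eq_invg_mul (sqr1 false).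
have gJ : (g ^ w1 = g^-1)%g.
  by rewrite gE conjgE invMg w1V w2V !mulgA (sqr1 true) // mul1g.
have gX k : (w1 * g ^- k = g ^+ k * w1)%g.
  by rewrite -expgVn -gJ -conjXg conjgE mulKVg.
have w2E' : w2 = (g ^+ h./2 * w1 * g ^- h./2)%g.
  rewrite -gX -mulgA -invMg -expgD addnn.
  have -> : (g ^- (h./2).*2 = g)%g.
    by apply/eqP; rewrite eq_invg_mul -expgSr -hE expg_order.
  by rewrite {1}gE mulgA (sqr1 true) // mul1g.
have : \tr (rW w2) = \tr (rW w1).
  rewrite w2E' repr_mxM ?groupM ?groupV ?groupX // mxtrace_mulC.
  by rewrite -repr_mxM ?groupM ?groupV ?groupX // mulgA mulVg mul1g.
rewrite w1E w2E !refl_prod_orthonormal_trace; try exact: part_orthonormal.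
rewrite size_drop size_takel size_tuple // => /addrI/oppr_inj.
have two : (2 : R) != 0 by rewrite pnatr_eq0.
move=> /(mulfI two)/eqP; rewrite eqr_nat => /eqP; lia.
Qed.

(* Go back along the alternating orbit of [a] to its last positive root, which is
   simple. The run of positive roots has at most [h] elements, since otherwise
   antisymmetry would contradict the period [2 * h]. *)
Lemma pos_rho a : Pos a ->
  exists (m : nat) (j : 'I_l), [/\ a = rW (g ^+ m)%g *m rho j,
    (j + m * l < num_rho rW sigma)%N &
    forall i, (i <= m)%N -> Pos (rW (g ^- i)%g *m a)].
Proof.
move=> Pa; have gW := coxeter_W hPhi hPos hsigmaPos.
have [c [c1 c2 c3]] := pos_functional hPos.
have h0 : (0 < h)%N by exact: order_gt0.
(* If the whole orbit of [a] under [g] were positive, its sum [v] would be a nonzero fixed vector of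
   [g]. *)
have [n nh nP] : exists2 n, (n < h)%N & ~ Pos (rW (g ^- n)%g *m a).
  apply: contrapT => nn.
  have allP n : (n < h)%N -> Pos (rW (g ^- n)%g *m a).
    by move=> nh; apply: contrapT => nP; apply: nn; exists n.
  pose v := \sum_(i < h) rW (g ^- i)%g *m a.
  have cv : 0 < dot c v.
    rewrite /v dot_sumr (bigD1 (Ordinal h0)) //= ltr_wpDr //.
      by apply: sumr_ge0 => i _; apply/ltW/c1/allP.
    exact/c1/(allP 0%N).
  suff v0 : v = 0 by move: cv; rewrite v0 dot0r ltxx.
  apply: (coxeter_fixpoint_free hsigma);
    rewrite -(coxeterE hPhi hPos hsigmaPos).
  rewrite /v mulmx_sumr; case E : h h0 => [//|h'] _.
  rewrite big_ord_recl [RHS]big_ord_recr /= expg0 invg1 addrC.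
  congr (_ + _); last first.
    apply: eq_bigr => i _;
      rewrite /bump /= add1n mulmxA -repr_mxM ?groupV ?groupX //.
    by rewrite expgSr invMg mulKVg.
  rewrite repr_mx1 mul1mx; congr (rW _ *m _).
  by apply/eqP; rewrite eq_sym eq_invg_mul -expgSr -E expg_order eqxx.
have [q qn qmin] : exists2 q, (q <= n.*2)%N & ~ Pos (alt true q a) /\
    forall k, (k < q)%N -> Pos (alt true k a).
  have ex : exists q, `[< ~ Pos (alt true q a) >].
    by exists n.*2; apply/asboolP; rewrite alt_true_double.
  case: (ex_minnP ex) => q /asboolP qP qm; exists q.
    by apply: qm; apply/asboolP; rewrite alt_true_double.
  split=> // k kq; apply: contrapT => kP; move: kq; rewrite ltnNge.
  by rewrite qm //; apply/asboolP.
case: q qn qmin => [|p] pn [pP qmin]; first by case: pP.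
have [pin flip] := alt_flip (qmin p (ltnSn p)) pP.
have anti := alt_antisym flip.
have ph : (p < h)%N.
  rewrite ltnNge; apply/negP => hp.
  have e : (p.+1 + (h.*2 - p.+1) = h.*2)%N by lia.
  have kp : (h.*2 - p.+1 <= p)%N by lia.
  have := anti _ kp; rewrite e -[h.*2]addn0 alt_period /= => aE.
  apply: (pos_notopp hPhi hPos Pa); rewrite [a in - a]aE opprK; apply: qmin.
  by lia.
have posi m i : (m.*2 <= p)%N -> (i <= m)%N -> Pos (rW (g ^- i)%g *m a).
  by move=> mp im; rewrite -alt_true_double; apply: qmin; lia.
have aE m b : rW (g ^- m)%g *m a = b -> a = rW (g ^+ m)%g *m b.
  by move=> <-; rewrite mulmxA -repr_mxM ?groupV ?groupX // mulgV repr_mx1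
    mul1mx.
have /part_nth[i iE ir] := pin.
have il := ltn_ord i.
have pE := odd_double_half p.
(* For odd [p] the simple root lies in the second part, and the leftover factor [part_refl true] is
   the one in [rho_false]; for even [p] it lies in the first part. *)
case op : (odd p) pE ir => pE /=; rewrite ?addbT /= => ir.
  exists p./2, i; split; last by move=> k; apply: posi; lia.
    apply: aE; rewrite -alt_true_double rho_false; last by rewrite leqNgt ir.
    rewrite -tnth_nth -iE -pE add1n /= odd_double /= part_reflK.
    by congr alt; lia.
  rewrite /num_rho; have : ((p./2).+1.*2 <= h)%N by lia.
  move=> le_h; apply: (@leq_trans (l * (p./2).+1)%N);
    first by rewrite mulnS mulnC; lia.
  by rewrite -[X in (X <= _)%N]doubleK half_leq // doubleMr leq_mul2l le_h orbT.
exists p./2, i; split; last by move=> k; apply: posi; lia.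
  by apply: aE; rewrite -alt_true_double rho_true // -tnth_nth -iE; congr alt;
    lia.
(* For odd [h] the list may end in the middle of this block of [l] entries; [l = r.*2] and [i < r]
   place the root in the half that is kept. *)
rewrite /num_rho; case oh : (odd h).
  have lE := odd_coxeter_number oh.
  have : ((p./2).*2.+1 <= h)%N by lia.
  move=> le_h; apply: (@leq_trans (r * (p./2).*2.+1)%N); last first.
    have -> : ((l * h)./2 = r * h)%N by move: h => h';
      rewrite lE -doubleMl doubleK.
    by rewrite leq_mul2l le_h orbT.
  have -> : (p./2 * l = r * p./2.*2)%N by rewrite lE -!doubleMr mulnC.
  by rewrite mulnS ltn_add2r ir.
have : ((p./2).+1.*2 <= h)%N by have := odd_double_half h; rewrite oh; lia.
move=> le_h; apply: (@leq_trans (l * (p./2).+1)%N);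
  first by rewrite mulnS mulnC; lia.
by rewrite -[X in (X <= _)%N]doubleK half_leq // doubleMr leq_mul2l le_h orbT.
Qed.

(** * Signs of the Euler form on positive roots *)

Local Notation G := (refl_prod sigma).
Local Notation E := (euler G).

Lemma simple_norm (i : 'I_l) : dot sigma`_i sigma`_i = 1.
Proof.
by case/andP: (part_orthonormal (i < r)%N) => _ /allP/(_ _ (nth_part i))/eqP.
Qed.

Lemma pos_norm a : Pos a -> dot a a = 1.
Proof.
case/pos_rho => m [j [-> _ _]]; rewrite dot_orth ?rho_norm //.
by apply: (repr_orth hW); rewrite groupX // (coxeter_W hPhi hPos hsigmaPos).
Qed.

Lemma euler_rho (i : 'I_l) : exists2 z,
  forall j : 'I_l, dot z sigma`_j = (i == j)%:R & forall y, E (rho i) y = dot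
    z y.
Proof.
have ffG := coxeter_fixpoint_free hsigma.
have [z zs _] := refl_prod_dual (size_tuple sigma) ffG.
exists (z i) => [j|y]; first exact: zs.
rewrite (rho_lt hPhi hPos hsigmaPos) //.
by apply: (euler_refl_prod ffG _ erefl (size_tuple sigma) zs);
  exact: simple_norm.
Qed.

Lemma euler_rho_ge0 (i : 'I_l) y : Pos y -> 0 <= E (rho i) y.
Proof.
have [z zs ->] := euler_rho i; case/(pos_coef hPos hsigma hsigmaPos) => k -> k0.
rewrite dot_sumr sumr_ge0 // => j _; rewrite dotZr (tnth_nth 0) zs.
by rewrite mulr_ge0 ?ler0n.
Qed.

(** [rho j] lies in the span of the simple roots up to [j], none of which has an [i]-th
    coordinate. *)
Lemma euler_rho_lt (i j : 'I_l) : (j < i)%N -> E (rho i) (rho j) = 0.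
Proof.
have [z zs ->] := euler_rho i => ji; rewrite (rho_lt hPhi hPos hsigmaPos) //.
have zj q : (q <= j)%N -> dot z sigma`_q = 0.
  move=> qj; have qi := leq_ltn_trans qj ji.
  rewrite (zs (Ordinal (ltn_trans qi (ltn_ord i)))) -val_eqE /= eq_sym.
  by rewrite ltn_eqF.
rewrite refl_prod_linear; first exact: zj.
  by move=> k x y; rewrite dotBr dotZr.
move=> a /(nthP 0)[q]; rewrite size_takel => [qj <-|];
  last by rewrite size_tuple ltnW.
by rewrite nth_take //; exact/zj/ltnW.
Qed.

Definition refl_index (t : gT) : nat := index t (map (root_refl rW) (rho_seq
  rW sigma)).

(** Translate a supposed earlier occurrence back by its own power of [g]. For [- a] this contradicts
    positivity of the translates of [a]; for [a] at a smaller power it contradicts [coxeterV_rho];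
    at the same power [rho_inj] decides. *)
Lemma refl_index_rho a : Pos a ->
  exists (m : nat) (j : 'I_l), [/\ a = rW (g ^+ m)%g *m rho j,
    refl_index (root_refl rW a) = (j + m * l)%N, (j + m * l < num_rho rW
      sigma)%N &
    forall i, (i <= m)%N -> Pos (rW (g ^- i)%g *m a)].
Proof.
move=> Pa; have [m [j [aE jm posi]]] := pos_rho Pa; exists m, j; split=> //.
have gW := coxeter_W hPhi hPos hsigmaPos.
have l0 : (0 < l)%N by apply: leq_ltn_trans (ltn_ord j).
have rhoE := rho_mul hPhi hPos hsigmaPos _ _ l0.
have seqE n : (n < num_rho rW sigma)%N ->
    nth 1%g (map (root_refl rW) (rho_seq rW sigma)) n = root_refl rW (rho n).
  rewrite /rho_seq -map_comp; exact: nth_map_iota.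
have sizeE : size (map (root_refl rW) (rho_seq rW sigma)) = num_rho rW sigma.
  by rewrite 2!size_map size_iota.
apply: (@index_first _ 1%g);
  [by rewrite sizeE|by rewrite (seqE _ jm) rhoE -aE|].
move=> n nlt; rewrite seqE ?(ltn_trans nlt) //; apply/eqP => e.
have nE := divn_eq n l; rewrite addnC in nE.
pose j' := Ordinal (ltn_pmod n l0); pose m' := (n %/ l)%N.
have nE' : rho n = rW (g ^+ m')%g *m rho j' by rewrite nE rhoE.
have Pj' := rho_pos j'.
have Pn : Phi (rho n).
  by rewrite nE'; apply: (root_act hPhi); rewrite ?groupX //;
    exact: (posP hPos).
have le_m : (m' <= m)%N.
  rewrite -ltnS ltn_divLR //; apply: ltn_trans nlt _.
  by rewrite mulSn ltn_add2r.
have back : rW (g ^- m')%g *m rho n = rho j'.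
  by rewrite nE' mulmxA -repr_mxM ?groupV ?groupX // mulVg repr_mx1 mul1mx.
have : refl_mx (rho n) = refl_mx a.
  have [_ <-] := root_reflP hPhi Pn;
    have [_ <-] := root_reflP hPhi (posP hPos Pa).
  by rewrite e.
case/(root_refl_eq hPhi Pn (posP hPos Pa)) => rn; last first.
  have := posi _ le_m; rewrite -(opprK a) -rn mulmxN back.
  exact: (pos_notopp hPhi hPos Pj').
rewrite rn in back; have [ltm|gem] := ltnP m' m.
  have := posi _ ltm; rewrite -expgVn expgS repr_mxM ?groupX ?groupV //.
  by rewrite expgVn -mulmxA back; exact: coxeterV_rho.
have mm : m' = m by apply/eqP; rewrite eqn_leq le_m.
have jj : j' = j.
  apply: rho_inj; rewrite -back aE mm mulmxA -repr_mxM ?groupV ?groupX //.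
  by rewrite mulVg repr_mx1 mul1mx.
by move: nlt; rewrite nE -/m' mm -[(n %% l)%N]/(nat_of_ord j') jj ltnn.
Qed.

(* Translating by a power of [g], one of the two roots becomes one of the first [l]
   roots [rho i], for which [E (rho i)] is a coordinate with respect to [sigma];
   Serre duality exchanges the two roots. *)
Lemma euler_sign a b : Pos a -> Pos b ->
  ((refl_index (root_refl rW a) <= refl_index (root_refl rW b))%N -> 0 <= E a
    b) /\
  ((refl_index (root_refl rW b) < refl_index (root_refl rW a))%N -> E a b <= 0).
Proof.
move=> Pa Pb; have gW := coxeter_W hPhi hPos hsigmaPos.
have ffG := coxeter_fixpoint_free hsigma.
have GE := coxeterE hPhi hPos hsigmaPos.
have inv := repr_coxeterX_inv hW hPhi hPos hsigma hsigmaPos.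
have [m [i [aE -> _ posa]]] := refl_index_rho Pa.
have [n [j [bE -> _ posb]]] := refl_index_rho Pb.
have shift p q (v : 'cV[R]_l) : (q <= p)%N ->
    rW (g ^+ p)%g *m v = rW (g ^+ q)%g *m (rW (g ^+ (p - q))%g *m v).
  by move=> qp; rewrite mulmxA -repr_mxM ?groupX // -expgD subnKC.
have back p q (v : 'cV[R]_l) : (q <= p)%N -> rW (g ^- q)%g *m (rW (g ^+ p)%g
  *m v) =
    rW (g ^+ (p - q))%g *m v.
  move=> qp; rewrite (shift _ _ _ qp) mulmxA -repr_mxM ?groupV ?groupX //.
  by rewrite mulVg repr_mx1 mul1mx.
have il := ltn_ord i; have jl := ltn_ord j.
split=> [le_ab|lt_ba].
  have mn : (m <= n)%N.
    by rewrite -ltnS -(@ltn_pmul2r l) 1?(leq_ltn_trans _ il) // mulSn; lia.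
  rewrite aE bE (shift _ _ _ mn) inv -back // -bE.
  by apply: euler_rho_ge0; exact: posb.
have nm : (n <= m)%N.
  by rewrite -ltnS -(@ltn_pmul2r l) 1?(leq_ltn_trans _ il) // mulSn; lia.
rewrite aE bE (shift _ _ _ nm) inv.
case E0 : (m - n)%N => [|d].
  rewrite repr_mx1 mul1mx euler_rho_lt //.
  have : m = n by apply/eqP; rewrite eqn_leq nm -subn_eq0 E0.
  by move=> mn; move: lt_ba; rewrite mn ltn_add2r.
rewrite expgS repr_mxM ?groupX // -mulmxA GE.
have serre := euler_serre ffG (rho j); rewrite -[X in X <= 0]opprK -serre;
  last first.
  by rewrite -GE (repr_orth hW).
rewrite oppr_le0 euler_rho_ge0 // (_ : d = (m - n.+1)%N);
  last by rewrite subnS E0.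
have ltnm : (n < m)%N by rewrite -subn_gt0 E0.
by rewrite -back // -aE; exact: posa.
Qed.

Lemma reflections_pos t : t \in T -> exists a, Pos a /\ t = root_refl rW a.
Proof.
move=> tT; have [h1 h2 _] := hPhi; have [a Pa ha] := h2 t tT.
have /ha[_ ta] : a = a \/ a = - a by left.
have eq_t b : Phi b -> rW t = refl_mx b -> t = root_refl rW b.
  move=> Pb tb; have [_ bE] := root_reflP hPhi Pb.
  by apply: (repr_inj hW); rewrite ?(root_refl_W hPhi) ?(reflections_W tT) ?bE.
have [pa|npa] := EM (Pos a); first by exists a; split=> //; exact: eq_t.
exists (- a); split; first by apply/(pos_opp hPhi hPos).
by apply: eq_t; [exact: (root_opp hPhi) | rewrite refl_mxN].
Qed.

(** * Uniqueness of rising factorizations *)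

Definition pos_root (t : gT) : 'cV[R]_l :=
  if pselect (exists a, Pos a /\ t = root_refl rW a) is left ex
  then projT1 (cid ex) else 0.

Lemma pos_rootP t : t \in T -> Pos (pos_root t) /\ t = root_refl rW (pos_root
  t).
Proof.
move=> /reflections_pos ex; rewrite /pos_root.
by case: pselect => // ex'; case: (cid ex').
Qed.

Lemma refl_index_inj : {in T &, injective refl_index}.
Proof.
move=> s t sT tT e; have mem x : x \in T ->
    x \in map (root_refl rW) (rho_seq rW sigma).
  case/pos_rootP => Px xE; have [m [j [_ idx lt _]]] := refl_index_rho Px.
  rewrite -xE in idx.
  by rewrite -index_mem -/(refl_index _) idx !size_map size_iota.
by rewrite -(nth_index 1%g (mem s sT)) -(nth_index 1%g (mem t tT))
  -!/(refl_index _) e.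
Qed.

Lemma euler_index_sign s t : s \in T -> t \in T ->
  (refl_index t < refl_index s)%N -> E (pos_root s) (pos_root t) <= 0.
Proof.
move=> /pos_rootP[Ps sE] /pos_rootP[Pt tE]; have [_] := euler_sign Ps Pt.
by rewrite -sE -tE.
Qed.

Lemma repr_pos_root s : all (mem T) s ->
  rW (\prod_(t <- s) t)%g = refl_prod (map pos_root s).
Proof.
move=> /allP sT; have [|_ <-] := @repr_refl_prod _ _ _ _ _ _ hPhi (map
  pos_root s).
  by move=> _ /mapP[t /sT tT ->]; have [/(posP hPos)] := pos_rootP tT.
rewrite big_map; congr (rW _); apply: eq_big_seq => t /sT tT.
by have [_ <-] := pos_rootP tT.
Qed.

(* A shorter word is completed to length [l] by zero vectors, for which [refl_mx]
   is the identity. *)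
Lemma coxeter_length : abs_length T g = l.
Proof.
have gW := coxeter_W hPhi hPos hsigmaPos.
have GE := coxeterE hPhi hPos hsigmaPos.
apply/eqP; rewrite eqn_leq; apply/andP; split.
  have := @abs_length_prod _ T (map (root_refl rW) sigma).
  rewrite big_map size_map size_tuple; apply;
    apply/allP => _ /mapP[a /simple_mem Pa ->].
  by have [] := root_reflP hPhi (posP hPos (Pa _ hsigmaPos)).
have [s sz [sT sE]] := abs_lengthP (gen_reflections hW) gW.
rewrite -sz leqNgt; apply/negP => lt_sl.
pose e := map pos_root s ++ nseq (l - size s) (0 : 'cV[R]_l).
have eE : refl_prod e = G.
  rewrite refl_prod_cat -GE -sE repr_pos_root // -[RHS]mulmx1; congr (_ *m _).
  elim: (_ - _)%N => //= n ->; rewrite mulmx1 /refl_mx.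
  by rewrite mul0mx scaler0 subr0.
have sze : size e = l by rewrite size_cat size_map size_nseq subnKC // ltnW.
have [|z zs _] := refl_prod_dual sze.
  by rewrite eE; exact: (coxeter_fixpoint_free hsigma).
have := zs (Ordinal lt_sl) (Ordinal lt_sl); rewrite eqxx nth_cat size_map ltnn.
by rewrite nth_nseq if_same dot0r => /esym/eqP; rewrite oner_eq0.
Qed.

(* Otherwise the root of [b], expanded in the roots of [A], has nonpositive
   coefficients: the matrix of [E] on [A] is unitriangular with nonpositive
     entries
   off the diagonal, and [E] of the roots of [A] with that of [b] is
     nonpositive. *)
Lemma rising_min p A B q a A' b : all (mem T) (p ++ A ++ q) -> all (mem T) B ->
  (\prod_(t <- p ++ A ++ q) t)%g = g -> (\prod_(t <- A) t = \prod_(t <- B)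
    t)%g ->
  size A = size B -> size (p ++ A ++ q) = l -> rising refl_index A ->
  A = a :: A' -> b \in B -> (refl_index a <= refl_index b)%N.
Proof.
move=> pAqT BT pAqE AB sAB sz riseA AE bB; rewrite leqNgt; apply/negP => lt_ba.
have ffG := coxeter_fixpoint_free hsigma.
have := pAqT; rewrite !all_cat => /and3P[pT AT qT].
set f := p ++ A ++ q in pAqT pAqE sz.
have pBqT : all (mem T) (p ++ B ++ q) by rewrite !all_cat pT BT.
have GE : refl_prod (map pos_root f) = G.
  by rewrite -repr_pos_root // pAqE (coxeterE hPhi hPos hsigmaPos).
have GE' : refl_prod (map pos_root (p ++ B ++ q)) = G.
  rewrite -repr_pos_root // -(coxeterE hPhi hPos hsigmaPos) -pAqE !big_cat /=.
  by rewrite AB.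
have sze : size (map pos_root f) = l by rewrite size_map.
have [|z zs zy] := refl_prod_dual sze; first by rewrite GE.
have freeB : free (map pos_root B).
  have : free (map pos_root (p ++ B ++ q)).
    apply: refl_prod_free; last by rewrite GE'.
    by rewrite size_map -[RHS]sz !size_cat sAB.
  by rewrite !map_cat => /catr_free/catl_free.
have fT (i : 'I_l) : nth 1%g f i \in T.
  by apply: (allP pAqT); rewrite mem_nth // sz.
have eE (i : 'I_l) : (map pos_root f)`_i = pos_root (nth 1%g f i).
  by rewrite (nth_map 1%g) // sz.
pose inA i := (size p <= i)%N && (i < size p + size A)%N.
have fA i : inA i -> nth 1%g f i = nth 1%g A (i - size p).
  case/andP => pi iA; rewrite !nth_cat ltnNge pi /= ltn_subLR //.
  by rewrite iA.
pose y := pos_root b; have bT : b \in T by exact: (allP BT).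
have [Py bE] := pos_rootP bT.
(* A dual vector outside the block is orthogonal to the roots of [A], hence fixed by their product,
   which is the product of [B]. Independence of the roots of [B] makes it orthogonal to each of
   them. *)
have c0 (i : 'I_l) : ~~ inA i -> dot (z i) y = 0.
  move=> niA; rewrite dotC.
  have zA : refl_prod (map pos_root B) *m z i = z i.
    rewrite -repr_pos_root // -AB repr_pos_root //; apply: refl_prod_fix.
    move=> _ /mapP[t /(nthP 1%g)[j jA <-] ->].
    have pjA : inA (size p + j)%N by rewrite /inA leq_addr ltn_add2l.
    have pjl : (size p + j < l)%N.
      by rewrite -sz !size_cat addnA ltn_addr // ltn_add2l.
    have := zs i (Ordinal pjl); rewrite eE fA //= addKn dotC => ->.
    case: eqP => // e; by rewrite e /= pjA in niA.
  by apply: (refl_prod_fixed freeB zA); rewrite map_f.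
have exc : forall i j : 'I_l, (i <= j)%N ->
    E (map pos_root f)`_i (map pos_root f)`_j = (i == j)%:R.
  move=> i j; apply: (euler_exceptional ffG) => //.
  by move=> _ /mapP[t /(allP pAqT)/pos_rootP[Pt _] ->]; exact: pos_norm.
have sorted_nth := sorted_leq_nth (leT := [rel s t | (refl_index s <=
  refl_index t)%N])
  (fun _ _ _ => @leq_trans _ _ _) (fun _ => leqnn _) 1%g riseA.
have coef : forall i, dot (z i) y <= 0.
  apply: (coef_le0 (zy y) exc) => i; have [iA|/c0] := boolP (inA i);
    last by left.
  right; split.
    rewrite eE; apply: euler_index_sign => //; apply: leq_trans lt_ba _.
    have A0 : nth 1%g A 0 = a by rewrite AE.
    rewrite -A0 (fA _ iA); apply: sorted_nth; rewrite // inE;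
      first by rewrite AE.
    by case/andP: iA => pi iA; rewrite ltn_subLR.
  move=> j ji; have [jA|/c0] := boolP (inA j); last by left.
  right; rewrite !eE; apply: euler_index_sign => //; rewrite ltn_neqAle.
  have /andP[pi iA'] := iA; have /andP[pj jA'] := jA.
  apply/andP; split.
    apply/eqP => /(refl_index_inj (fT j) (fT i)) e.
    have := zs i j; rewrite eE e -eE zs eqxx -val_eqE /= gtn_eqF // => /eqP.
    by rewrite oner_eq0.
  rewrite (fA _ iA) (fA _ jA); apply: sorted_nth.
  - by rewrite inE ltn_subLR.
  - by rewrite inE ltn_subLR.
  by rewrite leq_sub2r // ltnW.
have [c [c1 _ _]] := pos_functional hPos.
have := c1 y Py; rewrite (zy y) dot_sumr ltNge sumr_le0 // => i _.
rewrite dotZr eE mulr_le0_ge0 //; apply/ltW/c1.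
by have [] := pos_rootP (fT i).
Qed.

(** [rising_min] in both directions identifies the first letters. The common letter moves to the
    prefix [p], so the rest is still a block of a full factorization of [g]. *)
Lemma rising_eq p A B q : all (mem T) (p ++ A ++ q) -> all (mem T) B ->
  (\prod_(t <- p ++ A ++ q) t)%g = g -> (\prod_(t <- A) t = \prod_(t <- B)
    t)%g ->
  size A = size B -> size (p ++ A ++ q) = l ->
  rising refl_index A -> rising refl_index B -> A = B.
Proof.
elim: A B p => [|a A IHA] [|b B] p // pAqT BT pAqE AB [sAB] sz riseA riseB.
have := pAqT; rewrite !all_cat => /and3P[pT AT qT].
have ab : a = b.
  apply: refl_index_inj; [by case/andP: AT|by case/andP: BT|].
  apply/eqP; rewrite eqn_leq; apply/andP; split.
    by apply: (rising_min pAqT BT pAqE AB _ sz riseA erefl);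
      rewrite /= ?sAB ?mem_head.
  apply: (@rising_min p (b :: B) (a :: A) q b B a) => //.
  - by rewrite !all_cat pT BT.
  - by rewrite -pAqE !big_cat /= AB.
  - by rewrite /= sAB.
  - by rewrite -sz !size_cat /= sAB.
  by rewrite mem_head.
rewrite -ab in AB BT riseB *; congr (_ :: _).
apply: (IHA B (rcons p a)); rewrite ?cat_rcons //.
- by case/andP: BT.
- by move: AB; rewrite !big_cons => /mulgI.
- exact: path_sorted riseA.
exact: path_sorted riseB.
Qed.

Local Notation NC := (noncrossing W T g).
Local Notation len := (abs_length T).

(** Reduced words of [u] and of [v^-1 * g] extend a word of the interval to a factorization of [g]
    with exactly [l] letters. *)
Lemma noncrossing_rising_unique u v s s' : u \in NC -> v \in NC -> abs_le T u
  v ->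
  s \in words T (len v - len u) -> s' \in words T (len v - len u) ->
  (\prod_(t <- s) t = u^-1 * v)%g -> (\prod_(t <- s') t = u^-1 * v)%g ->
  rising refl_index s -> rising refl_index s' -> s' = s.
Proof.
have gW := coxeter_W hPhi hPos hsigmaPos.
have genT := gen_reflections hW.
rewrite !inE => /and3P[uW _ ug] /and3P[vW _ vg] uv.
rewrite !mem_words => /andP[/eqP sz sT] /andP[/eqP sz' s'T] sE s'E rs rs'.
have [p szp [pT pE]] := abs_lengthP genT uW.
have [|q szq [qT qE]] := @abs_lengthP _ W T genT (v^-1 * g)%g.
  by rewrite groupM ?groupV.
apply: (@rising_eq p s' s q) => //.
- by rewrite !all_cat pT s'T.
- by rewrite !big_cat /= pE s'E qE -mulgA mulKVg mulKVg.
- by rewrite s'E sE.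
- by rewrite sz' sz.
rewrite !size_cat szp sz' szq (abs_length_div vg) coxeter_length.
have := abs_le_leq vg; have := abs_le_leq uv; rewrite coxeter_length.
by move: (len u) (len v) => m n mn nl; rewrite addnA subnKC // subnKC.
Qed.

(** * Lengths of the positive runs *)

(** Starting with the part not containing the simple root skips the trivial step to its negative and
    leads through the translates of [rho i] by powers of [g]. *)
Definition simple_path (i : 'I_l) (k : nat) : 'cV[R]_l := alt (~~ (i < r)%N) k
  sigma`_i.

Local Notation Y := simple_path.

Lemma part_reflE b v : part_refl b *m v =
  v - \sum_(j < l | (j < r)%N == b) (2 * dot sigma`_j v) *: sigma`_j.
Proof.
rewrite /part_refl refl_prod_orthonormal ?part_orthonormal // mulmxBl mul1mx.
congr (_ - _); rewrite -scalemxAl mulmx_suml scaler_sumr.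
pose s := [seq sigma`_(nat_of_ord j) | j : 'I_l <- enum 'I_l & (j < r)%N == b].
have ps : perm_eq (part b) s.
  apply: uniq_perm.
  - by case: (b); rewrite ?take_uniq ?drop_uniq // simple_uniq.
  - rewrite map_inj_in_uniq => [|i j _ _ e]; first by apply: filter_uniq;
      exact: enum_uniq.
    by apply/val_inj/(uniqP 0 simple_uniq);
      rewrite /= ?inE ?size_tuple ?ltn_ord.
  move=> a; apply/idP/mapP => [/part_nth[i -> <-]|[i]].
    by exists i; rewrite ?(tnth_nth 0) // mem_filter eqxx mem_enum.
  by rewrite mem_filter => /andP[/eqP <- _] ->; exact: nth_part.
rewrite (perm_big _ ps) big_map big_filter big_enum_cond.
apply: eq_bigr => j _; rewrite -mulmxA [_^T *m v]mx11_scalar -/(dot _ v).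
by rewrite mul_mx_scalar scalerA.
Qed.

Lemma simple_obtuse (i j : 'I_l) : i != j -> dot sigma`_i sigma`_j <= 0.
Proof.
move=> ij; have [z zs _] := euler_rho i.
have : Pos (refl_mx (tnth sigma i) *m tnth sigma j).
  apply: (pos_simple_refl hPhi hPos hsigma hsigmaPos) => // e.
  case/eqP: ij; apply/val_inj/(uniqP 0 simple_uniq);
    by rewrite /= ?inE ?size_tuple ?ltn_ord // -!tnth_nth.
case/(pos_coef hPos hsigma hsigmaPos) => k kE k0.
have := congr1 (dot z) kE;
  rewrite dot_sumr refl_mxE !(tnth_nth 0) simple_norm divr1.
rewrite dotBr dotZr !zs eqxx (negbTE ij) mulr1 sub0r => e.
have : 0 <= - (2 * dot sigma`_i sigma`_j).
  rewrite e sumr_ge0 // => q _; rewrite dotZr (tnth_nth 0) zs.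
  by rewrite mulr_ge0 ?ler0n.
by rewrite oppr_ge0 pmulr_rle0 // ltr0n.
Qed.

Definition neighbor_sum (i : 'I_l) (k : nat) : 'cV[R]_l :=
  \sum_(j < l | (j < r)%N == ~~ (i < r)%N) (- (2 * dot sigma`_j sigma`_i)) *:
    Y j k.

Lemma neighbor_sumS i k :
  neighbor_sum i k.+1 = part_refl ((i < r)%N (+) odd k) *m neighbor_sum i k.
Proof.
rewrite mulmx_sumr; apply: eq_bigr => j /eqP jb.
by rewrite -scalemxAr /Y altS jb negbK.
Qed.

Lemma simple_path1 i : Y i 1 = Y i 0 + neighbor_sum i 0.
Proof.
rewrite /Y altS /= addbF part_reflE /neighbor_sum; congr (_ + _).
by rewrite -sumrN; apply: eq_bigr => j _; rewrite scaleNr.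
Qed.

(* The mesh relations of the Auslander-Reiten quiver. *)
Lemma simple_path_mesh i k : Y i k.+2 + Y i k = neighbor_sum i k.+1.
Proof.
elim: k => [|k IHk].
  have -> : Y i 2 = part_refl (i < r)%N *m Y i 1.
    by rewrite /Y altS [odd 1]/= addbT negbK.
  rewrite neighbor_sumS [odd 0]/= addbF simple_path1 mulmxDr.
  by rewrite part_refl_opp ?nth_part // addrAC addNr add0r.
rewrite neighbor_sumS -IHk mulmxDr /Y altS [alt _ k.+1 _]altS.
by rewrite [odd k.+2]/= negbK [odd k.+1]/= addbN addNb.
Qed.

(** The orbit that starts with the root's own part first steps to the negative root and closes up
    after [h.*2] steps. Dropping that first step, [Y i] reaches the negative root after [h.*2 - 1]
    steps. *)
Lemma simple_path_negative i : exists k, `[< ~ Pos (Y i k.+1) >].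
Proof.
have h0 : (0 < h)%N by exact: order_gt0.
have := alt_period (i < r)%N 0 sigma`_i; rewrite addn0.
have -> : h.*2 = (1 + (h.*2).-1)%N by lia.
rewrite alt_add /= addbF addbT part_refl_opp ?nth_part // altN => e.
exists (h.*2).-2; apply/asboolP => YP.
apply: (pos_notopp hPhi hPos YP).
have -> : ((h.*2).-2.+1 = (h.*2).-1)%N by lia.
by rewrite e -tnth_nth.
Qed.

Definition run_length (i : 'I_l) : nat := (ex_minn (simple_path_negative i)).+1.

Lemma run_pos i k : (k < run_length i)%N -> Pos (Y i k).
Proof.
rewrite /run_length; case: ex_minnP => q _ qmin; case: k => [_|k kq].
  by rewrite /Y /= -tnth_nth.
apply: contrapT => nP; have := qmin k; rewrite leqNgt -ltnS kq => H.
by have := H (introT (asboolP _) nP).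
Qed.

Lemma run_neg i : ~ Pos (Y i (run_length i)).
Proof. by rewrite /run_length; case: ex_minnP => q /asboolP. Qed.

Lemma run_antisym i k : (k < run_length i)%N ->
  Y i (run_length i + k) = - Y i ((run_length i).-1 - k).
Proof.
have := @run_pos i; have := @run_neg i; rewrite /run_length.
move: (ex_minn _) => q nP P kq.
by have [_ fl] := alt_flip (P q (ltnSn q)) nP; exact: (alt_antisym fl).
Qed.

Lemma run_gt1 i : (1 < run_length i)%N.
Proof.
have r0 : (0 < run_length i)%N by [].
rewrite ltn_neqAle r0 andbT eq_sym; apply/eqP => r1.
have := @run_neg i; rewrite r1; apply.
rewrite /Y altS /= addbF; apply: contrapT => /(part_refl_flip _).
rewrite -tnth_nth => /(_ (hsigmaPos i)) /part_disjoint.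
by rewrite negbK (tnth_nth 0) nth_part.
Qed.

(* Adding the mesh relations at both sides of the sign change of [i] gives [0] on
   the left; on the right the terms of the neighbours are nonnegative, and
     vanish
   only if the sign changes at the same time. *)
Lemma run_neighbor i j : (forall j', (run_length i <= run_length j')%N) ->
  coxeter_graph sigma i j -> run_length j = run_length i.
Proof.
move=> imin; rewrite /coxeter_graph /= !(tnth_nth 0) => ij.
have [<-//|ne_ij] := eqVneq i j.
have jb : (j < r)%N == ~~ (i < r)%N.
  apply: contraNeq ij => /eqP; rewrite -!tnth_nth.
  case: ltnP => jr; case: ltnP => ir // _;
    [rewrite horth1 //|rewrite horth2 //];
    by rewrite (negbTE ne_ij).
set q := run_length i; have q1 := run_gt1 i; rewrite -/q in q1.
have [c [c1 _ _]] := pos_functional hPos.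
have sum0 : neighbor_sum i q + neighbor_sum i q.-1 = 0.
  have := simple_path_mesh i q.-1; have := simple_path_mesh i q.-2.
  have -> : (q.-2).+1 = q.-1 by lia.
  have -> : (q.-1).+1 = q by lia.
  move=> <- <-; have := run_antisym (ltnW q1); have := run_antisym q1.
  rewrite -/q addn0 subn0 addn1 subn1 => -> ->.
  by rewrite addrA addrK addNr.
have term j' : 0 <= dot c (Y j' q + Y j' q.-1) /\
    (dot c (Y j' q + Y j' q.-1) = 0 -> run_length j' = q).
  have := imin j'; rewrite -/q leq_eqVlt => /predU1P[e|lt_q].
    have := @run_antisym j' 0; rewrite -e addn0 subn0 => ->;
      last by rewrite ltnW.
    by rewrite addNr dot0r.
  have Yq := run_pos lt_q; have Yq' : Pos (Y j' q.-1) by apply: run_pos; lia.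
  rewrite dotDr; split; first by rewrite addr_ge0 // ltW // c1.
  by move=> e; have := addr_gt0 (c1 _ Yq) (c1 _ Yq'); rewrite e ltxx.
have := congr1 (dot c) sum0.
rewrite /neighbor_sum -big_split /= dot_sumr dot0r.
under eq_bigr do rewrite -scalerDr dotZr.
have nn (j' : 'I_l) : (j' < r)%N == ~~ (i < r)%N ->
    0 <= - (2 * dot sigma`_j' sigma`_i) * dot c (Y j' q + Y j' q.-1).
  move=> jb'; rewrite mulr_ge0 //; last by have [] := term j'.
  rewrite oppr_ge0 pmulr_rle0 ?ltr0n // simple_obtuse //.
  by apply: contraTneq jb' => ->; case: (i < r)%N.
move=> /eqP; rewrite psumr_eq0 // => /allP/(_ j (mem_index_enum _)).
rewrite jb implyTb mulf_eq0 oppr_eq0 mulf_eq0 pnatr_eq0 dotC (negbTE ij) /=.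
by move=> /eqP; have [_] := term j.
Qed.

Lemma run_component i j : (forall j', (run_length i <= run_length j')%N) ->
  connect (coxeter_graph sigma) i j -> run_length j = run_length i.
Proof.
move=> + /connectP[p ip ->] {j};
  elim: p i ip => //= j p IHp i /andP[ij jp] imin.
have e := run_neighbor imin ij.
by rewrite -e; apply: IHp => // j'; rewrite e.
Qed.

(** * Components of the Coxeter graph *)

Local Notation t_ j := (root_refl rW (tnth sigma j)).
Local Notation component_elt i :=
  (\prod_(j < l | connect (coxeter_graph sigma) i j) t_ j)%g.

Lemma simple_refl_act s (v : 'cV[R]_l) :
  rW (\prod_(j <- s) t_ j)%g *m v =
  foldr (fun j v => refl_mx (tnth sigma j) *m v) v s.
Proof.
have tP j := root_reflP hPhi (simple_root hPos hsigmaPos j).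
have tW j : t_ j \in W by have [/reflections_W] := tP j.
elim: s => [|j s IHs]; first by rewrite big_nil repr_mx1 mul1mx.
rewrite big_cons repr_mxM ?group_prod // -mulmxA IHs /=.
by have [_ ->] := tP j.
Qed.

(** Reflections outside the component act trivially on [v]; those inside add multiples of roots
    orthogonal to everything outside, so the condition persists. *)
Lemma component_act i (v : 'cV[R]_l) s :
  (forall n, ~~ connect (coxeter_graph sigma) i n -> dot (tnth sigma n) v = 0)
    ->
  let C := connect (coxeter_graph sigma) i in
  let act := foldr (fun j v => refl_mx (tnth sigma j) *m v) v in
  act s = act (filter C s) /\ forall n, ~~ C n -> dot (tnth sigma n) (act s) =
    0.
Proof.
move=> vC /=; elim: s => //= j s [IHs sC].
case: ifPn => [Cj|nCj]; last by rewrite refl_mx_fix ?sC.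
rewrite /= IHs; split=> // n nCn; rewrite refl_mxE dotBr dotZr -IHs sC //.
suff -> : dot (tnth sigma n) (tnth sigma j) = 0 by rewrite mulr0 subr0.
apply/eqP; apply: contraNT nCn => nj; apply: connect_trans Cj _.
by apply: connect1; rewrite /coxeter_graph /= dotC.
Qed.

Lemma coxeter_prod : g = (\prod_(j <- index_enum 'I_l) t_ j)%g.
Proof.
rewrite /coxeter_elt (big_nth 0) size_tuple big_mkord; apply: eq_bigr => j _.
by rewrite (tnth_nth 0).
Qed.

Lemma component_coxeter i m j : connect (coxeter_graph sigma) i j ->
  rW (component_elt i ^+ m)%g *m sigma`_j = rW (g ^+ m)%g *m sigma`_j.
Proof.
move=> Cj; have gW := coxeter_W hPhi hPos hsigmaPos.
have tW q : t_ q \in W by exact: (root_refl_W hPhi (simple_root hPos hsigmaPos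
  q)).
have CW : component_elt i \in W by rewrite group_prod.
pose D v := forall n, ~~ connect (coxeter_graph sigma) i n -> dot (tnth sigma
  n) v = 0.
suff [] : rW (component_elt i ^+ m)%g *m sigma`_j = rW (g ^+ m)%g *m sigma`_j /\
  D (rW (g ^+ m)%g *m sigma`_j) by [].
elim: m => [|m [IHm Dm]].
  rewrite !repr_mx1 !mul1mx; split=> // n nCn.
  apply/eqP; apply: contraNT nCn => nj; apply: connect_trans Cj _.
  by apply: connect1; rewrite /coxeter_graph /= dotC (tnth_nth 0 sigma j).
rewrite !expgS !repr_mxM ?groupX // -!mulmxA IHm.
move: (rW _ *m sigma`_j) Dm => v Dm.
have [e De] := component_act (index_enum 'I_l) Dm.
rewrite coxeter_prod simple_refl_act; split; last exact: De.
by rewrite -big_filter simple_refl_act e.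
Qed.

Lemma component_fix i m j : ~~ connect (coxeter_graph sigma) i j ->
  rW (component_elt i ^+ m)%g *m sigma`_j = sigma`_j.
Proof.
move=> nCj; have tW q : t_ q \in W.
  exact: (root_refl_W hPhi (simple_root hPos hsigmaPos q)).
have CW : component_elt i \in W by rewrite group_prod.
elim: m => [|m IHm]; first by rewrite repr_mx1 mul1mx.
rewrite expgS repr_mxM ?groupX // -mulmxA IHm -big_filter simple_refl_act.
have : {subset filter (connect (coxeter_graph sigma) i) (index_enum 'I_l) <=
    connect (coxeter_graph sigma) i} by move=> n; rewrite mem_filter => /andP[].
elim: (filter _ _) => //= n s IHs sC.
rewrite IHs => [|q qs]; last by apply: sC; rewrite inE qs orbT.
rewrite refl_mx_fix //; apply/eqP; apply: contraNT nCj => nj.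
apply: connect_trans (sC n (mem_head _ _)) _.
by apply: connect1; rewrite /coxeter_graph /= (tnth_nth 0 sigma j).
Qed.

Lemma repr_simple_inj x y : x \in W -> y \in W ->
  (forall j : 'I_l, rW x *m sigma`_j = rW y *m sigma`_j) -> x = y.
Proof.
move=> xW yW xy; apply: (repr_inj hW) => //.
have [z _ zy] := refl_prod_dual (size_tuple sigma) (coxeter_fixpoint_free
  hsigma).
have all_v (v : 'cV[R]_l) : rW x *m v = rW y *m v.
  rewrite (zy v) !mulmx_sumr; apply: eq_bigr => j _.
  by rewrite -!scalemxAr xy.
rewrite -[LHS]mulmx1 -[RHS]mulmx1; apply/trmx_inj/row_matrixP => j.
by apply: trmx_inj; rewrite -!tr_col !trmxK !colE -!mulmxA all_v.
Qed.

(** With [q] the run length, common to the component, antisymmetry puts the negative of each of its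
    simple roots at step [2q - 1], and the root's own part then restores the root. So the [q]-th
    power of [g] fixes these roots. *)
Lemma run_length_coxeter i : (forall j, (run_length i <= run_length j)%N) ->
  (component_coxeter_number rW sigma i <= run_length i)%N.
Proof.
move=> imin; apply: cyclic.order_inf; apply/eqP; rewrite -/(run_length i).
have gW := coxeter_W hPhi hPos hsigmaPos.
have CW : component_elt i \in W.
  apply: group_prod => q _;
    exact: (root_refl_W hPhi (simple_root hPos hsigmaPos q)).
apply: repr_simple_inj; rewrite ?groupX ?group1 // => j;
  rewrite repr_mx1 mul1mx.
have [Cj|] := boolP (connect (coxeter_graph sigma) i j);
  last exact: component_fix.
rewrite component_coxeter //; have e := run_component imin Cj.
have r0 : (0 < run_length i)%N by [].
have lt : ((run_length j).-1 < run_length j)%N by rewrite e prednK.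
have := run_antisym lt; rewrite subnn /Y [alt _ 0 _]/= => Yr.
have : alt (~~ (j < r)%N) (run_length j).*2 sigma`_j = sigma`_j.
  have -> : ((run_length j).*2 = (run_length j + (run_length j).-1).+1)%N by
    lia.
  rewrite altS Yr mulmxN.
  have -> : odd (run_length j + (run_length j).-1).
    by rewrite e; move: r0; case: (run_length i) => // q _;
      rewrite oddD /= addNb addbb.
  by rewrite addbT negbK part_refl_opp ?nth_part ?opprK.
rewrite e; case: (j < r)%N; rewrite ?alt_false_double ?alt_true_double // => fx.
rewrite -[in LHS]fx mulmxA -repr_mxM ?groupV ?groupX //.
by rewrite mulgV repr_mx1 mul1mx.
Qed.

Lemma num_rho_gt0 n : (n < num_rho rW sigma)%N -> (0 < l)%N.
Proof.
by rewrite /num_rho; case: (posnP l) => // l0; move: h => q; rewrite l0 mul0n.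
Qed.

Lemma rho_seq_pos : (forall i, component_coxeter_number rW sigma i = h) ->
  forall n, (n < num_rho rW sigma)%N -> Pos (rho n).
Proof.
move=> comp n nlt.
have l0 := num_rho_gt0 nlt.
(* A globally shortest run is at least as long as the Coxeter number of its component, here [h]. *)
have le_run i : (h <= run_length i)%N.
  have [i0 _ imin] := arg_minnP run_length (erefl : xpredT i).
  apply: leq_trans (imin i isT); rewrite -(comp i0).
  by apply: run_length_coxeter => j; exact: imin.
have nE := divn_eq n l; rewrite addnC in nE.
pose j := Ordinal (ltn_pmod n l0); set m := (n %/ l)%N in nE.
have jE : (n %% l)%N = j by [].
rewrite nE jE (rho_mul hPhi hPos hsigmaPos) //.
have Yj k : (k < h)%N -> Pos (Y j k).
  by move=> kh; apply: run_pos; exact: leq_trans kh (le_run j).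
have hE := odd_double_half h.
(* [rho n] is this entry of the path of [j]. For odd [h] the list ends with half a block of [l]
   entries, whence the case using [l = r.*2]. *)
have bound : (m.*2 + ~~ (j < r)%N < h)%N.
  move: nlt; rewrite nE jE /num_rho -{1}hE.
  case oh : (odd h) hE => hE.
    have lE := odd_coxeter_number oh.
    have -> : ((l * (true + h./2.*2))./2 = r + r * h./2.*2)%N.
      by move: (h./2.*2) => q; rewrite lE -doubleMl doubleK mulnDr muln1.
    have -> : (m * l = r * m.*2)%N by rewrite lE -!doubleMr mulnC.
    move=> lt; have mh : (m <= h./2)%N.
      rewrite leqNgt; apply/negP => hm.
      have : (r * (h./2.*2.+2) <= r * m.*2)%N by rewrite leq_mul2l; apply/orP;
        right; lia.
      by rewrite !mulnS; lia.
    case: (ltnP j r) => jr; first by rewrite -hE; lia.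
    rewrite -hE; suff : (m < h./2)%N by lia.
    rewrite ltn_neqAle mh andbT; apply/eqP => e; move: lt; rewrite e; lia.
  have -> : ((l * (false + h./2.*2))./2 = l * h./2)%N by rewrite add0n
    -doubleMr doubleK.
  move=> lt; suff : (m < h./2)%N by rewrite -hE; case: (ltnP j r); lia.
  rewrite ltnNge; apply/negP => hm; move: lt; rewrite ltnNge => /negP; apply.
  by rewrite mulnC (leq_trans (leq_mul hm (leqnn l))) // leq_addl.
case jb : (j < r)%N bound => bound.
  rewrite rho_true // -alt_false_double; have := Yj m.*2.
  by rewrite /Y jb; apply; lia.
have rj : (r <= j)%N by rewrite leqNgt jb.
rewrite (rho_false rj) -alt_false_double.
have -> : alt false m.*2 (part_refl true *m sigma`_j) = Y j (1 + m.*2).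
  by rewrite /Y jb alt_add.
by apply: Yj; rewrite add1n -addn1.
Qed.

(** Translate two equal entries back by the smaller power of [g]. If the powers differ, [g^-1] sends
    some [rho j] to a listed, hence positive, root, against [coxeterV_rho]; otherwise [rho_inj]
    applies. *)
Lemma rho_seq_uniq : (forall i, component_coxeter_number rW sigma i = h) ->
  uniq (rho_seq rW sigma).
Proof.
move=> comp; have posn := rho_seq_pos comp.
have gW := coxeter_W hPhi hPos hsigmaPos.
rewrite map_inj_in_uniq ?iota_uniq // => n n'; rewrite !mem_iota !add0n /=.
move=> nlt nlt' e; have l0 := num_rho_gt0 nlt.
suff wlg q q' : (q < num_rho rW sigma)%N -> (q' < num_rho rW sigma)%N ->
    (q %/ l <= q' %/ l)%N -> rho q = rho q' -> q = q'.
  by have [le|/ltnW le] := leqP (n %/ l) (n' %/ l); [|apply/esym]; apply: wlg.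
move=> qlt qlt' le {}e.
have qE := divn_eq q l; rewrite addnC in qE; pose j := Ordinal (ltn_pmod q l0).
have qE' := divn_eq q' l; rewrite addnC in qE';
  pose j' := Ordinal (ltn_pmod q' l0).
have eq_j : rho j = rho (q' - (q %/ l) * l)%N.
  have : rW (g ^- (q %/ l))%g *m rho q = rW (g ^- (q %/ l))%g *m rho q' by
    rewrite e.
  rewrite {2}qE (rho_mul hPhi hPos hsigmaPos) // mulmxA -repr_mxM ?groupV
    ?groupX //.
  rewrite mulVg repr_mx1 mul1mx => ->.
  have lq : (q %/ l * l <= q')%N.
    by rewrite -leq_divRL.
  rewrite -{1}(subnK lq) (rho_mul hPhi hPos hsigmaPos) // mulmxA.
  by rewrite -repr_mxM ?groupV ?groupX // mulVg repr_mx1 mul1mx.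
have [lt|ge] := ltnP (q %/ l) (q' %/ l).
  case: (@coxeterV_rho j); rewrite eq_j.
  have lq : (l <= q' - q %/ l * l)%N.
    have le_q : (q %/ l * l <= q')%N by rewrite -leq_divRL.
    by rewrite leq_subRL // addnC -mulSn -leq_divRL.
  rewrite -(subnKC lq) (rho_add hPhi hPos hsigmaPos) // mulmxA -repr_mxM
    ?groupV //.
  rewrite mulVg repr_mx1 mul1mx; apply: posn; apply: leq_ltn_trans qlt'.
  by rewrite (leq_trans (leq_subr _ _)) // leq_subr.
have qq : (q %/ l = q' %/ l)%N by apply/eqP; rewrite eqn_leq le.
have jj : j = j'.
  by apply: rho_inj; rewrite eq_j; congr (rho _); rewrite qq {1}qE' addnK.
by rewrite qE qE' qq; congr (_ + _)%N; rewrite -[LHS]/(nat_of_ord j) jj.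
Qed.

End Bipartite.

Theorem corollary4p3 (R : realType) (gT : finGroupType) (W : {group gT})
    (l : nat) (rW : mx_representation R W l)
    (Phi Pos : 'cV[R]_l -> Prop) (sigma : l.-tuple 'cV[R]_l) (r : nat)
    (hW : real_reflection_group rW)
    (hPhi : root_system rW Phi)
    (hPos : positive_system Phi Pos)
    (hsigma : simple_system Phi sigma)
    (hsigmaPos : forall i, Pos (tnth sigma i))
    (hr : (r <= l)%N)
    (horth1 : forall i j : 'I_l, (i < r)%N -> (j < r)%N ->
       dot (tnth sigma i) (tnth sigma j) = (i == j)%:R)
    (horth2 : forall i j : 'I_l, (r <= i)%N -> (r <= j)%N ->
       dot (tnth sigma i) (tnth sigma j) = (i == j)%:R) :
  let T := reflections rW in
  let gamma := coxeter_elt rW sigma in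
  let NC := noncrossing W T gamma in
  [/\ forall a, Pos a -> a \in rho_seq rW sigma,
      (forall i, component_coxeter_number rW sigma i = coxeter_number rW
        sigma) ->
        uniq (rho_seq rW sigma) /\
        (forall a, Pos a <-> a \in rho_seq rW sigma)
    & forall u v, u \in NC -> v \in NC -> abs_le T u v ->
        mobius NC (abs_le T) u v =
        (-1) ^+ (abs_length T v - abs_length T u)%N *
        (#|falling_maximal_chains NC (abs_le T) (refl_le rW sigma) u v|)%:Z].
Proof.
move=> T gamma NC.
have pos_rho_seq a : Pos a -> a \in rho_seq rW sigma.
  case/(pos_rho hW hPhi hPos hsigma hsigmaPos hr horth1 horth2) => m [j [-> jm
    _]].
  rewrite -(rho_mul hPhi hPos hsigmaPos) ?(leq_ltn_trans _ (ltn_ord j)) //.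
  by rewrite map_f // mem_iota.
split=> // [comp|u v uN vN uv].
  split; first exact: (rho_seq_uniq hW hPhi hPos hsigma hsigmaPos hr horth1
    horth2 comp).
  move=> a; split=> [|/mapP[n]]; first exact: pos_rho_seq.
  rewrite mem_iota => /andP[_ nlt] ->.
  exact: (rho_seq_pos hW hPhi hPos hsigma hsigmaPos hr horth1 horth2 comp nlt).
have genT := gen_reflections hW; have invT := @reflections_invol _ _ _ _ _ hW.
have conjT := @reflections_conj _ _ _ _ _ hW.
have k_inj := refl_index_inj hW hPhi hPos hsigma hsigmaPos hr horth1 horth2.
have gW : gamma \in W := coxeter_W hPhi hPos hsigmaPos.
rewrite (mobiusE genT invT conjT k_inj gW) //; last first.
  exact: (noncrossing_rising_unique hW hPhi hPos hsigma hsigmaPos hr horth1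
    horth2).
rewrite /signed_count; congr (_ * _).
exact: (word_count_chains genT gW).
Qed.
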